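(* Let $k$ be a field, $Q$ a finite quiver and $A:=kQ/\langle Q_2\rangle$. The graded Lie algebra structure on $HH^{*+1}(A)=\bigoplus_{n\ge1}HH^n(A)$ given by the Gerstenhaber bracket is induced by the graded Lie algebra structure on $C^{*+1}(Q)=\bigoplus_{n\ge1}k(Q_n\parallel Q_0)\oplus k(Q_n\parallel Q_1)$ given by $[-,-]_Q$; that is, $[-,-]_Q$ passes to the cohomology of the complex $C^\bullet(Q)$ in degrees $\ge1$ and, under the identification of this cohomology with $HH^{*+1}(A)$, it gives the Gerstenhaber bracket.
   Context: $Q_n$ is the set of paths of length $n$ in $Q$ ($Q_0$ vertices, identified with trivial paths; $Q_1$ arrows); $kQ$ is the path algebra, $\langle Q_2\rangle$ the two-sided ideal generated by paths of length two. $A=E\oplus r$ with $E=kQ_0$ and Jacobson radical $r=kQ_1$. Two paths are parallel if they have the same source and the same end. For sets of paths $X,Y$, $X\parallel Y=\{(\gamma,\gamma')\in X\times Y:\gamma\parallel\gamma'\}$, and $k(X\parallel Y)$ is the vector space with basis $X\parallel Y$. The complex $C^\bullet(Q)$ has degree-$n$ term $k(Q_n\parallel Q_0)\oplus k(Q_n\parallel Q_1)$ ($n\ge0$) and differential $\begin{pmatrix} 0 & 0 \\ {D_n} & 0 \end{pmatrix}$, where $D_n:k(Q_n\parallel Q_0)\to k(Q_{n+1}\parallel Q_1)$, $D_n(\gamma^n,e)=\sum_{a\in Q_1e}(a\gamma^n,a)+(-1)^{n+1}\sum_{a\in eQ_1}(\gamma^na,a)$ ($Q_1e$, resp. $eQ_1$,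 is the set of arrows $a$ with $ae=a$, resp. $ea=a$, in $kQ$). It is isomorphic (Cibils) to the reduced complex $C_E^n(r,A)=\mathrm{Hom}_{E^e}(r^{\otimes_En},A)$ (with $E^e=E^{op}\otimes_kE$ and $C_E^0(r,A)=A^E=\{a\in A: ae=ea\ \forall e\in E\}$), which has the usual Hochschild differential and cohomology $HH^n(A)$; a basis element $(\alpha,x)\in Q_n\parallel(Q_0\cup Q_1)$ corresponds, for $n\ge1$, to the map sending $\alpha$ to $x$ and all other paths of length $n$ to $0$. The reduced complex is identified in cohomology with the Hochschild complex $\mathrm{Hom}_k(A^{\otimes_kn},A)$ by $f\mapsto\big(x_1\otimes\cdots\otimes x_n\mapsto f(\pi(x_1)\otimes_E\cdots\otimes_E\pi(x_n))\big)$, $\pi:A\to r$ being the projection along $A=E\oplus r$. Write $\alpha^n=a_1\cdots a_n$ with $a_i\in Q_1$. For $n,m\ge1$, $1\le i\le n$, $(\alpha^n,x)\mathbin{\underset{i}{\circ}}(\beta^m,y)=\delta_{a_i,y}(\alpha^n\mathbin{\underset{i}{\diamond}}\beta^m,x)$, where $\alpha^n\mathbin{\underset{i}{\diamond}}\beta^m$ is obtained from $\alpha^n$ by replacing $a_i$ with the (parallel) path $\beta^m$, and $\delta_{a_i,y}$ is $1$ if $a_i=y$ and $0$ otherwise. Then $$[(\alpha^n,x),(\beta^m,y)]_Q=\sum_{i=1}^n(-1)^{(i-1)(m-1)}(\alpha^n,x)\mathbin{\underset{i}{\circ}}(\beta^m,y)-(-1)^{(n-1)(m-1)}\sum_{i=1}^m(-1)^{(i-1)(n-1)}(\beta^m,y)\mathbin{\underset{i}{\circ}}(\alpha^n,x).$$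 Gerstenhaber bracket: for $f\in\mathrm{Hom}_k(A^{\otimes n},A)$, $g\in\mathrm{Hom}_k(A^{\otimes m},A)$, $f\circ g=\sum_{i=1}^n(-1)^{(i-1)(m-1)}f\circ_ig$, where $f\circ_ig$ inserts $g$ in the $i$-th argument of $f$, and $[f,g]=f\circ g-(-1)^{(n-1)(m-1)}g\circ f$, which induces a bracket on cohomology. Elements of cohomological degree $n$ have Lie degree $n-1$. *)

(* Defs.v *)
From HB Require Import structures.
From mathcomp Require Import all_boot all_algebra.
From mathcomp Require Import boolp functions.
From mathcomp Require Import freeg.

Set Implicit Arguments.
Unset Strict Implicit.
Unset Printing Implicit Defensive.

Import GRing.Theory.
Local Open Scope ring_scope.
Local Open Scope quotient_scope.

Section QuotientRing.
Variables (R : pzRingType) (S : R -> Prop).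

Definition two_sided_ideal (I : R -> Prop) : Prop :=
  [/\ I 0, forall x y, I x -> I y -> I (x - y),
      forall a x, I x -> I (a * x) & forall a x, I x -> I (x * a)].

Definition gen_ideal : {pred R} :=
  fun x => `[< forall I, two_sided_ideal I -> (forall s, S s -> I s) -> I x >].

Lemma gen_idealP x :
  reflect (forall I, two_sided_ideal I -> (forall s, S s -> I s) -> I x)
          (x \in gen_ideal).
Proof. exact: asboolP. Qed.

Fact gen_ideal_zmod : zmod_closed gen_ideal.
Proof.
split=> [|x y /gen_idealP Ix /gen_idealP Iy]; apply/gen_idealP => I idI SI.
  by case: idI.
by case: (idI) => _ IB _ _; apply: IB; [apply: Ix | apply: Iy].
Qed.
HB.instance Definition _ := GRing.isZmodClosed.Build R gen_ideal gen_ideal_zmod.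

Lemma gen_idealMl a x : x \in gen_ideal -> a * x \in gen_ideal.
Proof.
move=> /gen_idealP Ix; apply/gen_idealP => I idI SI.
by case: (idI) => _ _ IM _; apply: IM; apply: Ix.
Qed.

Lemma gen_idealMr a x : x \in gen_ideal -> x * a \in gen_ideal.
Proof.
move=> /gen_idealP Ix; apply/gen_idealP => I idI SI.
by case: (idI) => _ _ _ IM; apply: IM; apply: Ix.
Qed.

Definition ring_quot : Type := {ideal_quot gen_ideal}.
HB.instance Definition _ := GRing.Zmodule.on ring_quot.
HB.instance Definition _ := Quotient.on ring_quot.

Definition qproj (x : R) : ring_quot := \pi_({ideal_quot gen_ideal}) x.
Definition qrepr (u : ring_quot) : R := repr (u : {ideal_quot gen_ideal}).

Lemma qreprK u : qproj (qrepr u) = u.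
Proof. exact: reprK. Qed.

Lemma qprojP x y : reflect (qproj x = qproj y) (x - y \in gen_ideal).
Proof. by rewrite Quotient.idealrBE; apply: eqP. Qed.

Lemma qproj_repr x : qrepr (qproj x) - x \in gen_ideal.
Proof. by apply/qprojP; rewrite qreprK. Qed.

Lemma qprojD x y : qproj (x + y) = qproj x + qproj y.
Proof. exact: (Quotient.pi_add gen_ideal). Qed.

Definition qone : ring_quot := qproj 1.
Definition qmul (u v : ring_quot) : ring_quot := qproj (qrepr u * qrepr v).

Lemma qprojM x y : qproj (x * y) = qmul (qproj x) (qproj y).
Proof.
apply/esym/qprojP.
have -> : qrepr (qproj x) * qrepr (qproj y) - x * y =
    (qrepr (qproj x) - x) * qrepr (qproj y) + x * (qrepr (qproj y) - y).
  by rewrite mulrBl mulrBr addrA subrK.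
by apply: rpredD; [apply: gen_idealMr | apply: gen_idealMl]; apply: qproj_repr.
Qed.

Local Ltac lift_repr u := rewrite -[u]qreprK; move: (qrepr u) => {}u.

Fact qmulA : associative qmul.
Proof.
by move=> u v w; lift_repr u; lift_repr v; lift_repr w; rewrite -!qprojM mulrA.
Qed.
Fact qmul1r : left_id qone qmul.
Proof. by move=> u; lift_repr u; rewrite -!qprojM mul1r. Qed.
Fact qmulr1 : right_id qone qmul.
Proof. by move=> u; lift_repr u; rewrite -!qprojM mulr1. Qed.
Fact qmulDl : left_distributive qmul +%R.
Proof.
move=> u v w; lift_repr u; lift_repr v; lift_repr w.
by rewrite -!qprojM -!qprojD -qprojM mulrDl.
Qed.
Fact qmulDr : right_distributive qmul +%R.
Proof.
move=> u v w; lift_repr u; lift_repr v; lift_repr w.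
by rewrite -!qprojM -!qprojD -qprojM mulrDr.
Qed.
HB.instance Definition _ := GRing.Zmodule_isPzRing.Build ring_quot
  qmulA qmul1r qmulr1 qmulDl qmulDr.

End QuotientRing.

Record quiver := Quiver {
  vert : finType;
  arr : finType;
  src : arr -> vert;
  tgt : arr -> vert
}.

(* The path a_1 ... a_n satisfies tgt a_i = src a_(i+1), so that a b != 0 in kQ
   iff tgt a = src b: for an arrow a and a vertex e, a e = a iff tgt a = e, and
   e a = a iff src a = e.  A path is stored with its source because a path
   without arrows is a vertex. *)
Section Paths.
Variable Q : quiver.

Fixpoint walk (v : vert Q) (s : seq (arr Q)) : bool :=
  if s is a :: s' then (src a == v) && walk (tgt a) s' else true.

Record qpath := QPath {
  path_data : vert Q * seq (arr Q);
  path_dataP : walk path_data.1 path_data.2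
}.
HB.instance Definition _ := [isSub for path_data].
HB.instance Definition _ := [Choice of qpath by <:].

Definition psrc (p : qpath) : vert Q := (path_data p).1.
Definition arrows (p : qpath) : seq (arr Q) := (path_data p).2.
Definition pend (p : qpath) : vert Q := last (psrc p) (map (@tgt Q) (arrows p)).
Definition plen (p : qpath) : nat := size (arrows p).

Fact arrow_subproof (a : arr Q) : walk (src a) [:: a].
Proof. by rewrite /= eqxx. Qed.
Definition trivial_path (v : vert Q) : qpath := @QPath (v, [::]) isT.
Definition arrow_path (a : arr Q) : qpath := @QPath (src a, [:: a]) (arrow_subproof a).

Lemma walk_cat v s t :
  walk v (s ++ t) = walk v s && walk (last v (map (@tgt Q) s)) t.
Proof. by elim: s v => [|a s IHs] v //=; rewrite IHs andbA. Qed.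

Definition composable (p q : qpath) : bool := pend p == psrc q.

Fact pcat_subproof p q : composable p q -> walk (psrc p) (arrows p ++ arrows q).
Proof.
by move=> /eqP pq; rewrite walk_cat (path_dataP p) -/(pend p) pq (path_dataP q).
Qed.

Definition pcat (p q : qpath) : option qpath :=
  if composable p q then insub (psrc p, arrows p ++ arrows q) else None.

Definition parallel (p q : qpath) : bool := (psrc p == psrc q) && (pend p == pend q).

Lemma pcatP p q : composable p q ->
  exists2 r, pcat p q = Some r & path_data r = (psrc p, arrows p ++ arrows q).
Proof.
move=> pq; rewrite /pcat pq.
by case: insubP => [r _ rE|]; [exists r | rewrite pcat_subproof].
Qed.

Lemma pcatN p q : ~~ composable p q -> pcat p q = None.
Proof. by rewrite /pcat => /negPf ->. Qed.

Lemma pend_cat p q r : composable p q ->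
  path_data r = (psrc p, arrows p ++ arrows q) -> pend r = pend q.
Proof.
move=> /eqP pq rE; rewrite /pend /psrc /arrows rE /= map_cat last_cat.
by rewrite -/(pend p) pq.
Qed.

Lemma pcatA p q r :
  obind (pcat^~ r) (pcat p q) = obind (pcat p) (pcat q r).
Proof.
have [pq|npq] := boolP (composable p q); last first.
  rewrite pcatN //=; have [qr|nqr] := boolP (composable q r); last by rewrite pcatN.
  have [t -> tE] := pcatP qr; rewrite /= pcatN //.
  by rewrite /composable /psrc tE.
have [s -> sE] := pcatP pq; rewrite /=.
have sr : composable s r = composable q r by rewrite /composable (pend_cat pq sE).
have [qr|nqr] := boolP (composable q r); last by rewrite !pcatN ?sr.
have [t -> tE] := pcatP qr; rewrite /=.
have [|u -> uE] := @pcatP s r; first by rewrite sr.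
have [|v -> vE] := @pcatP p t; first by rewrite /composable /psrc tE.
congr Some; apply: val_inj; rewrite /= uE vE.
by rewrite /psrc /arrows sE tE /= catA.
Qed.

Lemma pcat_trivl v p : pcat (trivial_path v) p = if v == psrc p then Some p else None.
Proof.
have [e|ne] := boolP (composable (trivial_path v) p); last first.
  by rewrite pcatN //; move: ne; rewrite /composable /pend /= => /negPf ->.
move: (e); rewrite {1}/composable {1}/pend /= => ve; rewrite ve.
have [r -> rE] := pcatP e; congr Some; apply: val_inj; rewrite /= rE /=.
by rewrite [v](eqP ve) /psrc /arrows; case: (path_data p).
Qed.

Lemma pcat_trivr p v : pcat p (trivial_path v) = if pend p == v then Some p else None.
Proof.
have [e|ne] := boolP (composable p (trivial_path v)); last first.
  by rewrite pcatN //; move: ne; rewrite /composable => /negPf ->.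
move: (e); rewrite {1}/composable => ve; rewrite ve.
have [r -> rE] := pcatP e; congr Some; apply: val_inj; rewrite /= rE /=.
by rewrite cats0 /psrc /arrows; case: (path_data p).
Qed.

End Paths.

Section FgliftTheory.
Variables (k : fieldType) (K : choiceType) (M : lmodType k).
Implicit Types (f g : K -> M) (x y : {freeg K / k}).

Lemma fglift_is_linear f : linear (fglift f).
Proof.
have liftB : zmod_morphism (fglift f) := lift_is_additive f.
have lift0 : fglift f 0 = 0 by rewrite -[X in fglift f X](subrr 0) liftB subrr.
have liftD x y : fglift f (x + y) = fglift f x + fglift f y.
  by rewrite -[in LHS](opprK y) liftB -[in LHS](sub0r y) liftB lift0 sub0r opprK.
have lift_sum (r : seq K) (F : K -> {freeg K / k}) :
    fglift f (\sum_(z <- r) F z) = \sum_(z <- r) fglift f (F z).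
  by elim: r => [|z r IHr]; rewrite ?big_nil // !big_cons liftD IHr.
have liftE x : fglift f x = \sum_(z <- dom x) coeff z x *: f z.
  by rewrite -[in LHS](freeg_sumE x) lift_sum; apply: eq_bigr => z _; rewrite liftU.
move=> c x y; rewrite liftD; congr (_ + _).
rewrite [X in fglift f X = _]/GRing.scale /= /fgscale lift_sum liftE scaler_sumr.
by apply: eq_bigr => z _; rewrite liftU scalerA.
Qed.
HB.instance Definition _ f :=
  GRing.isLinear.Build k {freeg K / k} M *:%R (fglift f) (fglift_is_linear f).

Lemma fglift_basis f p : fglift f << p >> = f p.
Proof. by rewrite liftU scale1r. Qed.

Lemma fglift_lin (c : k) f g x :
  fglift (fun p => c *: f p + g p) x = c *: fglift f x + fglift g x.
Proof.
rewrite -[x]freeg_sumE !linear_sum -big_split /=.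
by apply: eq_bigr => z _; rewrite !liftU scalerDr !scalerA mulrC.
Qed.

Lemma eq_fglift f g : f =1 g -> fglift f =1 fglift g.
Proof.
move=> fg x; rewrite -[x]freeg_sumE !linear_sum /=; apply: eq_bigr => z _.
by rewrite !liftU fg.
Qed.

Lemma fglift_ext (f g : {freeg K / k} -> M) :
  linear f -> linear g -> (forall p, f << p >> = g << p >>) -> f =1 g.
Proof.
move=> fL gL fg x.
pose f' := HB.pack f (GRing.isLinear.Build k {freeg K / k} M *:%R f fL)
  : {linear {freeg K / k} -> M}.
pose g' := HB.pack g (GRing.isLinear.Build k {freeg K / k} M *:%R g gL)
  : {linear {freeg K / k} -> M}.
rewrite -[f]/(f' : _ -> _) -[g]/(g' : _ -> _) -[x]freeg_sumE !linear_sum /=.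
apply: eq_bigr => z _; have -> : << coeff z x *g z >> = coeff z x *: << z >>.
  by apply/eqP/freeg_eqP => t; rewrite coeffZ !coeffU mul1r.
by rewrite -[f]/(f' : _ -> _) -[g]/(g' : _ -> _) !linearZ /= fg.
Qed.

End FgliftTheory.

Section PathAlgebra.
Variables (k : fieldType) (Q : quiver).

Definition path_alg : Type := {freeg (qpath Q) / k}.
HB.instance Definition _ := GRing.Lmodule.on path_alg.

Definition path_elt (p : qpath Q) : path_alg := << p >>.
Definition opath_elt (o : option (qpath Q)) : path_alg :=
  if o is Some p then path_elt p else 0.

Definition pa_one : path_alg := \sum_(v : vert Q) path_elt (trivial_path v).
Definition pa_mul (x y : path_alg) : path_alg :=
  fglift (fun p => fglift (fun q => opath_elt (pcat p q)) y) x.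

Lemma pa_mulE p q : pa_mul (path_elt p) (path_elt q) = opath_elt (pcat p q).
Proof. by rewrite /pa_mul !fglift_basis. Qed.

Fact pa_mul_linl y : linear (pa_mul^~ y).
Proof. exact: fglift_is_linear. Qed.

Fact pa_mul_linr x : linear (pa_mul x).
Proof.
move=> c y z; rewrite /pa_mul -fglift_lin; apply: eq_fglift => p.
exact: fglift_is_linear.
Qed.

Lemma pa_mul_oeltl o q :
  pa_mul (opath_elt o) (path_elt q) = opath_elt (obind (fun p => pcat p q) o).
Proof. by case: o => [p|] /=; [exact: pa_mulE | exact: linear0]. Qed.

Lemma pa_mul_oeltr p o :
  pa_mul (path_elt p) (opath_elt o) = opath_elt (obind (pcat p) o).
Proof.
case: o => [q|] /=; first exact: pa_mulE.
by rewrite -[in LHS](subrr 0) -scaleN1r addrC pa_mul_linr scaleN1r addNr.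
Qed.

Fact pa_mulA : associative pa_mul.
Proof.
move=> x y z; move: x; apply: fglift_ext => [|c x x'|p]; first exact: pa_mul_linl.
  by rewrite !pa_mul_linl.
move: y; apply: fglift_ext => [c y y'|c y y'|q].
- by rewrite pa_mul_linl pa_mul_linr.
- by rewrite pa_mul_linr pa_mul_linl.
move: z; apply: fglift_ext => [c z z'|c z z'|r].
- by rewrite !pa_mul_linr.
- by rewrite pa_mul_linr.
by rewrite !pa_mulE pa_mul_oeltl pa_mul_oeltr pcatA.
Qed.

Fact pa_mulDl : left_distributive pa_mul +%R.
Proof. by move=> x y z; rewrite -[x]scale1r pa_mul_linl !scale1r. Qed.

Fact pa_mulDr : right_distributive pa_mul +%R.
Proof. by move=> x y z; rewrite -[y]scale1r pa_mul_linr !scale1r. Qed.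

Fact pa_mul1r : left_id pa_one pa_mul.
Proof.
apply: fglift_ext => [|c x y|p] //; first exact: pa_mul_linr.
rewrite /pa_one (big_morph (pa_mul^~ _) (fun x y => pa_mulDl x y _) (linear0 _)) /=.
rewrite (bigD1 (psrc p)) //= big1 => [|v /negPf vp]; rewrite pa_mulE pcat_trivl.
  by rewrite eqxx addr0.
by rewrite vp.
Qed.

Fact pa_mulr1 : right_id pa_one pa_mul.
Proof.
apply: fglift_ext => [|c x y|p] //; first exact: pa_mul_linl.
have pa0 x : pa_mul x 0 = 0.
  by apply: (addrI (pa_mul x 0)); rewrite -pa_mulDr !addr0.
rewrite /pa_one (big_morph (pa_mul _) (pa_mulDr _) (pa0 _)) /=.
rewrite (bigD1 (pend p)) //= big1 => [|v /negPf vp]; rewrite pa_mulE pcat_trivr.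
  by rewrite eqxx addr0.
by rewrite eq_sym vp.
Qed.

HB.instance Definition _ := GRing.Zmodule_isPzRing.Build path_alg
  pa_mulA pa_mul1r pa_mulr1 pa_mulDl pa_mulDr.

Lemma pa_scaleAl (c : k) (x y : path_alg) : c *: (x * y) = (c *: x) * y.
Proof.
have := pa_mul_linl y c x 0; rewrite addr0 => xy; rewrite [RHS]xy.
by rewrite -[pa_mul 0 y]/(0 * y) mul0r addr0.
Qed.

Lemma pa_scaleAr (c : k) (x y : path_alg) : c *: (x * y) = x * (c *: y).
Proof.
have := pa_mul_linr x c y 0; rewrite addr0 => xy; rewrite [RHS]xy.
by rewrite -[pa_mul x 0]/(x * 0) mulr0 addr0.
Qed.

Definition path_of_length2 (x : path_alg) : Prop :=
  exists2 p, plen p = 2 & x = path_elt p.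

Definition radsq0 : Type := ring_quot path_of_length2.
HB.instance Definition _ := GRing.PzRing.on radsq0.

Definition rs_scale (c : k) (u : radsq0) : radsq0 := qproj _ (c *: qrepr u).

Lemma qprojZ c x : qproj path_of_length2 (c *: x) = rs_scale c (qproj _ x).
Proof.
apply/esym/qprojP; rewrite -scalerBr -[_ - x]mul1r pa_scaleAl.
by apply: gen_idealMl; apply: qproj_repr.
Qed.

Local Ltac lift_repr u := rewrite -[u]qreprK; move: (qrepr u) => {}u.

Fact rs_scaleA a b u : rs_scale a (rs_scale b u) = rs_scale (a * b) u.
Proof. by lift_repr u; rewrite -!qprojZ scalerA. Qed.
Fact rs_scale1 : left_id 1 rs_scale.
Proof. by move=> u; lift_repr u; rewrite -!qprojZ scale1r. Qed.
Fact rs_scaleDr : right_distributive rs_scale +%R.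
Proof.
move=> c u v; lift_repr u; lift_repr v.
by rewrite -!qprojZ -!qprojD -qprojZ scalerDr.
Qed.
Fact rs_scaleDl u : {morph rs_scale^~ u : a b / a + b}.
Proof. by move=> a b; lift_repr u; rewrite -!qprojZ -qprojD scalerDl. Qed.
HB.instance Definition _ := GRing.Zmodule_isLmodule.Build k radsq0
  rs_scaleA rs_scale1 rs_scaleDr rs_scaleDl.

Lemma rs_scaleAl (c : k) (u v : radsq0) : c *: (u * v) = (c *: u) * v.
Proof.
rewrite -[LHS]/(rs_scale c (qmul u v)) -[RHS]/(qmul (rs_scale c u) v).
by lift_repr u; lift_repr v; rewrite -qprojM -!qprojZ -qprojM pa_scaleAl.
Qed.
Lemma rs_scaleAr (c : k) (u v : radsq0) : c *: (u * v) = u * (c *: v).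
Proof.
rewrite -[LHS]/(rs_scale c (qmul u v)) -[RHS]/(qmul u (rs_scale c v)).
by lift_repr u; lift_repr v; rewrite -qprojM -!qprojZ -qprojM pa_scaleAr.
Qed.

End PathAlgebra.

Section GradedLie.
Variable k : fieldType.

Definition submodule (V : lmodType k) (P : V -> Prop) : Prop :=
  P 0 /\ forall (c : k) (x y : V), P x -> P y -> P (c *: x + y).

(* The brackets br i j make the graded space (+)_i Z i / B i a graded Lie
   algebra, with Z i / B i in Lie degree i. *)
Record graded_lie (V : lmodType k) (Z B : nat -> V -> Prop)
    (br : nat -> nat -> V -> V -> V) : Prop := GradedLie {
  gl_submodZ : forall i, submodule (Z i);
  gl_submodB : forall i, submodule (B i);
  gl_sub : forall i x, B i x -> Z i x;
  gl_closed : forall i j x y, Z i x -> Z j y -> Z (i + j)%N (br i j x y);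
  gl_ideall : forall i j x y, B i x -> Z j y -> B (i + j)%N (br i j x y);
  gl_idealr : forall i j x y, Z i x -> B j y -> B (i + j)%N (br i j x y);
  gl_linl : forall i j c x x' y, Z i x -> Z i x' -> Z j y ->
    B (i + j)%N (br i j (c *: x + x') y - (c *: br i j x y + br i j x' y));
  gl_linr : forall i j c x y y', Z i x -> Z j y -> Z j y' ->
    B (i + j)%N (br i j x (c *: y + y') - (c *: br i j x y + br i j x y'));
  gl_antisym : forall i j x y, Z i x -> Z j y ->
    B (i + j)%N (br i j x y + (-1) ^+ (i * j) *: br j i y x);
  gl_jacobi : forall i j l x y z, Z i x -> Z j y -> Z l z ->
    B (i + j + l)%N
      ((-1) ^+ (i * l) *: br i (j + l)%N x (br j l y z)
       + (-1) ^+ (j * i) *: br j (l + i)%N y (br l i z x)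
       + (-1) ^+ (l * j) *: br l (i + j)%N z (br i j x y))
}.

(* phi induces an isomorphism (+)_i Z i / B i -> (+)_i Z' i / B' i
   carrying the brackets br to br'. *)
Record graded_lie_iso (V V' : lmodType k)
    (Z B : nat -> V -> Prop) (br : nat -> nat -> V -> V -> V)
    (Z' B' : nat -> V' -> Prop) (br' : nat -> nat -> V' -> V' -> V')
    (phi : V -> V') : Prop := GradedLieIso {
  gli_linear : linear phi;
  gli_maps : forall i x, Z i x -> Z' i (phi x);
  gli_inj : forall i x, Z i x -> (B i x <-> B' i (phi x));
  gli_surj : forall i y, Z' i y -> exists2 x, Z i x & B' i (phi x - y);
  gli_bracket : forall i j x y, Z i x -> Z j y ->
    B' (i + j)%N (phi (br i j x y) - br' i j (phi x) (phi y))
}.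

Definition cocycle (V : lmodType k) (C : nat -> V -> Prop) (d : nat -> V -> V)
    (n : nat) (x : V) : Prop :=
  C n x /\ d n x = 0.

Definition coboundary (V : lmodType k) (C : nat -> V -> Prop) (d : nat -> V -> V)
    (n : nat) (x : V) : Prop :=
  if n is m.+1 then exists2 y, C m y & x = d m y else x = 0.

End GradedLie.

Section ParallelComplex.
Variables (k : fieldType) (Q : quiver).

Definition ppair : Type :=
  {gx : qpath Q * qpath Q | parallel gx.1 gx.2 && (plen gx.2 <= 1)%N}.
HB.instance Definition _ := Choice.on ppair.

(* The direct sum over n >= 0 of k(Q_n || Q_0) (+) k(Q_n || Q_1); the summand of
   index n is CQ_deg n. *)
Definition CQ : Type := {freeg ppair / k}.
HB.instance Definition _ := GRing.Lmodule.on CQ.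

Definition CQ_deg (n : nat) (c : CQ) : Prop :=
  forall b, b \in dom c -> plen (val b).1 = n.

(* The basis element (g, x); in all uses below g exists and is parallel to x. *)
Definition pair_elt (g : option (qpath Q)) (x : qpath Q) : CQ :=
  if obind (fun p => insub (p, x) : option ppair) g is Some b then << b >> else 0.

Definition D_basis (b : ppair) : CQ :=
  let: (g, e) := val b in
  if plen e == 0%N then
    \sum_(a | tgt a == psrc e) pair_elt (pcat (arrow_path a) g) (arrow_path a)
    + (-1) ^+ (plen g).+1 *:
      \sum_(a | src a == psrc e) pair_elt (pcat g (arrow_path a)) (arrow_path a)
  else 0.

Definition D : CQ -> CQ := fglift D_basis.

Definition replace_arrow (p : qpath Q) (i : nat) (q : qpath Q) : option (qpath Q) :=
  insub (psrc p, take i (arrows p) ++ arrows q ++ drop i.+1 (arrows p)).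

Definition circ_basis (b c : ppair) (i : 'I_(plen (val b).1)) : CQ :=
  let: (beta, y) := val c in
  if y == arrow_path (tnth (in_tuple (arrows (val b).1)) i)
  then pair_elt (replace_arrow (val b).1 i beta) (val b).2 else 0.

(* The arrow positions i, j below start at 0 instead of 1. *)
Definition bracketQ_basis (b c : ppair) : CQ :=
  let n := plen (val b).1 in
  let m := plen (val c).1 in
  \sum_(i < n) (-1) ^+ (i * m.-1) *: circ_basis c i
  - (-1) ^+ (n.-1 * m.-1) *: \sum_(j < m) (-1) ^+ (j * n.-1) *: circ_basis b j.

Definition bracketQ (x y : CQ) : CQ :=
  fglift (fun b => fglift (fun c => bracketQ_basis b c) y) x.

End ParallelComplex.

(* Hom_k(A^{(x) n}, A) is the space of n-linear maps, encoded as functions on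
   lists that vanish on the lists of length different from n. *)
Section Hochschild.
Variables (k : fieldType) (A : lmodType k) (mul : A -> A -> A).
Implicit Types (f g : seq A -> A) (s : seq A).

Definition hcochain (n : nat) (f : seq A -> A) : Prop :=
  (forall s, size s <> n -> f s = 0) /\
  (forall s t (c : k) x y, (size s + size t).+1 = n ->
     f (s ++ (c *: x + y) :: t) = c *: f (s ++ x :: t) + f (s ++ y :: t)).

Definition hdiff (n : nat) (f : seq A -> A) : seq A -> A := fun s =>
  if size s == n.+1 then
    mul s`_0 (f (behead s))
    + \sum_(i < n) (-1) ^+ i.+1 *:
        f (take i s ++ mul s`_i s`_i.+1 :: drop i.+2 s)
    + (-1) ^+ n.+1 *: mul (f (take n s)) s`_n
  else 0.

Definition gcirc (n m : nat) (f g : seq A -> A) : seq A -> A := fun s =>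
  if size s == (n + m).-1 then
    \sum_(i < n) (-1) ^+ (i * m.-1) *:
      f (take i s ++ g (take m (drop i s)) :: drop (i + m) s)
  else 0.

Definition gbracket (n m : nat) (f g : seq A -> A) : seq A -> A :=
  gcirc n m f g - (-1) ^+ (n.-1 * m.-1) *: gcirc m n g f.

End Hochschild.

Section Identification.
Variables (k : fieldType) (Q : quiver).
Local Notation A := (radsq0 k Q).

Definition rs_path (p : qpath Q) : A := qproj _ (path_elt k p).

(* Coordinate of u on the path p of length at most 1; it does not depend on the
   representative of u, as the paths in <Q_2> have length at least 2. *)
Definition rs_coef (p : qpath Q) (u : A) : k := coeff p (qrepr u).

Definition rad_proj (u : A) : A :=
  \sum_(a : arr Q) rs_coef (arrow_path a) u *: rs_path (arrow_path a).

(* On arguments in r, this is the map r (x)_E ... (x)_E r = kQ_n -> A sending the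
   path g to x and the other paths of length n to 0. *)
Definition reduced_cochain (b : ppair Q) : seq A -> A := fun s =>
  let: (g, x) := val b in
  if size s == plen g then
    (\prod_(au <- zip (arrows g) s) rs_coef (arrow_path au.1) au.2) *: rs_path x
  else 0.

Definition inflate (f : seq A -> A) : seq A -> A := fun s => f (map rad_proj s).

Definition theta (c : CQ k Q) : seq A -> A := inflate (fglift reduced_cochain c).

End Identification.

(* Main.v *)
Require Import Defs.
From mathcomp Require Import all_boot all_algebra.
From mathcomp Require Import boolp functions.
From mathcomp Require Import freeg.
From mathcomp Require Import ring zify.

Set Implicit Arguments.
Unset Strict Implicit.
Unset Printing Implicit Defensive.

Import GRing.Theory.
Local Open Scope ring_scope.

(** The comparison map [theta] sends a basis element (g, x) of C(Q) to the
    multilinear map that reads the coordinates of its arguments along g and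
    returns the corresponding multiple of x.  Two compatibilities hold on the
    level of cochains, not merely up to coboundaries: [theta] commutes with the
    differentials ([theta_D]) and takes [-, -]_Q to the Gerstenhaber bracket
    ([theta_bracket]).  The latter is clear: the value of theta (h, y) is a
    multiple of y, so, inserted as i-th argument of theta (g, x), it contributes
    its coordinate on the i-th arrow of g, which is 0 unless that arrow is y.
    Since [theta] is moreover injective and detects degrees ([theta_inj],
    [CQ_degP]), every property of the bracket of C(Q), on cochains and on
    cohomology, is inherited from the Hochschild complex
    ([graded_lie_pullback]).  Two things then remain.

    The first is the theorem of Gerstenhaber that the bracket of Hochschild
    cochains is a graded Lie bracket and passes to cohomology.  Successive
    insertions of h and g into a cochain are either nested or side by side, and
    the side by side ones are symmetric up to sign ([ins_ins]); this is the
    graded pre-Lie identity ([pre_lie]), from which the Jacobi identity follows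
    in the form of a Leibniz rule ([lie_leibniz]).  The Hochschild differential
    is the bracket with the multiplication ([hdiffE]), hence a derivation
    ([hdiff_lie]), and its square vanishes because the multiplication is
    associative ([lie_mul2_sq]).

    The second is that [theta] is a quasi-isomorphism.  For a cochain f let K f
    be the cochain ([path_proj]) obtained by projecting the arguments onto the
    paths g = a_1 ... a_n and replacing the value f(a_1, ..., a_n) by its
    component e f(a_1, ..., a_n) e' between the source e and the end e' of g.
    That component is a combination of vertices and arrows parallel to g, so the
    image of K is the image of [theta] ([path_proj_image], [path_proj_theta]).
    The operator

      (H f)(x_1, ..., x_n) =
        sum over 0 <= i <= n and over the paths g = a_(i+1) ... a_n, of
        (-1)^i g(x_(i+1), ..., x_n) f(x_1, ..., x_i, e, a_(i+1), ..., a_n) e',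

    in which g(x_(i+1), ..., x_n) is the product of the coordinates of the
    x_j on the a_j, satisfies d H + H d = K - id ([homotopy_formula]).  It comes
    from the bimodule maps between the bar resolution and the resolution of A
    by the bimodules generated by the paths; in one direction these send a path to
    the word of its arrows, which is a chain map because products of arrows
    vanish in A.  Thus K induces the identity on cohomology, which gives
    surjectivity of [theta] there, and injectivity too, for theta c = d f implies
    theta c = K (theta c) = d (K f).

    Cochains are functions on lists, and the operators above are defined by
    recursion on the list of arguments, without reference to the degree of the
    cochain: fixing the first argument of a multilinear map leaves a multilinear
    map ([fix_head]), and each identity becomes an induction. *)

(** * Linear identities in a module *)

Section ModuleExpressions.
Variables (k : fieldType) (V : lmodType k).

Inductive mexpr : Type :=
  MAtom of nat | MZero | MAdd of mexpr & mexpr | MOpp of mexpr | MScale of k & mexpr.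

Fixpoint meval (env : seq V) (e : mexpr) : V :=
  match e with
  | MAtom i => env`_i
  | MZero => 0
  | MAdd e1 e2 => meval env e1 + meval env e2
  | MOpp e1 => - meval env e1
  | MScale c e1 => c *: meval env e1
  end.

Fixpoint mcoef (e : mexpr) (i : nat) : k :=
  match e with
  | MAtom j => if eqn j i then 1 else 0
  | MZero => 0
  | MAdd e1 e2 => mcoef e1 i + mcoef e2 i
  | MOpp e1 => - mcoef e1 i
  | MScale c e1 => c * mcoef e1 i
  end.

Lemma mevalE env e : meval env e = \sum_(i < size env) mcoef e i *: env`_i.
Proof.
elim: e => [j||e1 IH1 e2 IH2|e1 IH1|c e1 IH1] /=.
- have [lt_j|ge_j] := ltnP j (size env); last first.
    rewrite nth_default // big1 // => i _; rewrite eqnE; case: eqP => [ji|_]; last by rewrite scale0r.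
    by move: (ltn_ord i); rewrite -ji ltnNge ge_j.
  rewrite (bigD1 (Ordinal lt_j)) //= !eqnE eqxx scale1r big1 ?addr0 // => i.
  by rewrite -val_eqE /= eq_sym => /negPf ->; rewrite scale0r.
- by rewrite big1 // => i _; rewrite scale0r.
- by rewrite IH1 IH2 -big_split; apply: eq_bigr => i _; rewrite scalerDl.
- by rewrite IH1 -sumrN; apply: eq_bigr => i _; rewrite scaleNr.
- by rewrite IH1 scaler_sumr; apply: eq_bigr => i _; rewrite scalerA.
Qed.

Fixpoint mcoef_eq (n : nat) (e1 e2 : mexpr) : Prop :=
  if n is n'.+1 then mcoef e1 n' = mcoef e2 n' /\ mcoef_eq n' e1 e2 else True.

Lemma meval_eq env e1 e2 :
  mcoef_eq (size env) e1 e2 -> meval env e1 = meval env e2.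
Proof.
move=> E; rewrite !mevalE; apply: eq_bigr => i _; congr (_ *: _).
elim: (size env) E (nat_of_ord i) (ltn_ord i) => [|n IHn] //= [En En1] j.
by rewrite ltnS leq_eqVlt => /predU1P[->|/IHn->].
Qed.

End ModuleExpressions.

Ltac matom_mem v env :=
  lazymatch env with
  | nil => constr:(false)
  | cons v _ => constr:(true)
  | cons _ ?env' => matom_mem v env'
  end.
Ltac matoms t env :=
  lazymatch t with
  | 0 => env
  | ?x + ?y => let env' := matoms x env in matoms y env'
  | - ?x => matoms x env
  | _ *: ?x => matoms x env
  | _ => let b := matom_mem t env in
         lazymatch b with true => env | false => constr:(cons t env) end
  end.
Ltac mindex v env :=
  lazymatch env with
  | cons v _ => constr:(0%N)
  | cons _ ?env' => let i := mindex v env' in constr:(S i)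
  end.
Ltac mquote k t env :=
  lazymatch t with
  | 0 => constr:(@MZero k)
  | ?x + ?y => let ex := mquote k x env in let ey := mquote k y env in
               constr:(@MAdd k ex ey)
  | - ?x => let ex := mquote k x env in constr:(@MOpp k ex)
  | ?c *: ?x => let ex := mquote k x env in constr:(@MScale k c ex)
  | _ => let i := mindex t env in constr:(@MAtom k i)
  end.
(** The tactic [ring] does not apply to vectors.  An identity between linear
    combinations of the same vectors is reduced here to the equalities of the
    coefficients of each vector, which [ring] can settle. *)
Ltac module_coef :=
  lazymatch goal with
  | |- @eq ?T ?lhs ?rhs =>
    let env0 := matoms lhs (@nil T) in
    let env := matoms rhs env0 in
    let f := constr:(@meval_eq _ _ env) in
    lazymatch type of f with
    | forall e1 : @mexpr ?k, _ =>
      let e1 := mquote k lhs env in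
      let e2 := mquote k rhs env in
      apply: (f e1 e2); cbn [mcoef_eq mcoef size eqn];
      repeat (split; [|]); try exact: I; try ring
    end
  end.

(** * Insertion of cochains and the Gerstenhaber bracket *)

Section Insertion.
Variables (k : fieldType) (A : lmodType k).
Implicit Types (f g h phi psi : seq A -> A) (s t : seq A).

Definition multilinear phi : Prop :=
  forall s t (c : k) x y,
    phi (s ++ (c *: x + y) :: t) = c *: phi (s ++ x :: t) + phi (s ++ y :: t).

Definition homogeneous n phi : Prop := forall s, size s <> n -> phi s = 0.

Definition fix_head phi (x : A) : seq A -> A := fun s => phi (x :: s).

Lemma hcochainP n f : hcochain n f <-> homogeneous n f /\ multilinear f.
Proof.
split=> [[f0 fl]|[f0 fl]]; last by split=> // s t c x y _; apply: fl.
split=> // s t c x y.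
have [nst|nst] := eqVneq (size s + size t).+1 n; first exact: fl.
have z u : f (s ++ u :: t) = 0.
  by apply: f0; rewrite size_cat /= addnS; apply/eqP.
by rewrite !z scaler0 addr0.
Qed.

Lemma multilinear_fix_head phi x : multilinear phi -> multilinear (fix_head phi x).
Proof. by move=> phil s t c y z; exact: (phil (x :: s)). Qed.

Lemma multilinear0 phi s t : multilinear phi -> phi (s ++ 0 :: t) = 0.
Proof.
move=> phil; have := phil s t (-1) 0 0.
by rewrite scaler0 addr0 scaleN1r addNr.
Qed.

Lemma multilinearD phi s t x y : multilinear phi ->
  phi (s ++ (x + y) :: t) = phi (s ++ x :: t) + phi (s ++ y :: t).
Proof. by move=> phil; rewrite -[x]scale1r phil !scale1r. Qed.

Lemma multilinearZ phi s t c x : multilinear phi ->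
  phi (s ++ (c *: x) :: t) = c *: phi (s ++ x :: t).
Proof. by move=> phil; rewrite -[c *: x]addr0 phil multilinear0 // addr0. Qed.

Lemma multilinear_head phi c x y t : multilinear phi ->
  phi ((c *: x + y) :: t) = c *: phi (x :: t) + phi (y :: t).
Proof. by move=> phil; apply: (phil [::]). Qed.

(** The sum of all insertions of g, as a cochain of degree m, into phi; [insE]
    is the closed form.  The exponent m + 1 has the parity of m - 1 and remains
    correct for m = 0, a case that matters because the coboundaries of degree 1
    are the differentials of cochains of degree 0. *)
Fixpoint ins m g phi s {struct s} : A :=
  if s is x :: t then
    phi (g (take m s) :: drop m s) + (-1) ^+ m.+1 *: ins m g (fix_head phi x) t
  else phi [:: g [::]].

Lemma eq_ins m g phi psi : phi =1 psi -> ins m g phi =1 ins m g psi.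
Proof.
move=> + s; elim: s phi psi => [|x t IH] phi psi e /=; first by rewrite e.
by rewrite e (IH _ (fix_head psi x)) // => s; apply: e.
Qed.

Lemma ins_linphi m g c phi psi s :
  ins m g (c *: phi + psi) s = c *: ins m g phi s + ins m g psi s.
Proof.
elim: s phi psi => [|x t IH] phi psi //=.
rewrite -[fix_head _ x]/(c *: fix_head phi x + fix_head psi x) IH.
by rewrite !scalerDr !scalerA addrACA [_ * c]mulrC.
Qed.

Lemma ins_zero_phi m g s : ins m g 0 s = 0.
Proof. by have := ins_linphi m g (-1) 0 0 s; rewrite scaler0 addr0 scaleN1r addNr. Qed.

Lemma ins_lin m c g h phi s : multilinear phi ->
  ins m (c *: g + h) phi s = c *: ins m g phi s + ins m h phi s.
Proof.
elim: s phi => [|x t IH] phi phil /=; first exact: multilinear_head.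
rewrite IH; last exact: multilinear_fix_head.
rewrite -[(c *: g + h) _]/(c *: g _ + h _) multilinear_head //.
by rewrite !scalerDr !scalerA addrACA [_ * c]mulrC.
Qed.

Lemma ins_zero m phi s : multilinear phi -> ins m 0 phi s = 0.
Proof.
by move=> phil; have := ins_lin m (-1) 0 0 s phil; rewrite scaler0 addr0 scaleN1r addNr.
Qed.

Lemma ins_post m g f phi r s :
  (forall c x y, phi ((c *: x + y) :: r) = c *: phi (x :: r) + phi (y :: r)) ->
  ins m g (fun l => phi (f l :: r)) s = phi (ins m g f s :: r).
Proof.
move=> phil; elim: s f => [|x t IH] f //=.
by rewrite [in RHS]addrC phil -IH addrC.
Qed.

(** An inserted h falls either into the block of arguments consumed by the
    first variable of psi, which then extends over m + p - 1 of the original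
    arguments, or behind this block, at the price of the sign for passing m
    arguments. *)
Lemma ins_split m p h (psi : seq A -> seq A -> A) s :
  (forall l r, size l <> m -> psi l r = 0) ->
  ins p h (fun l => psi (take m l) (drop m l)) s =
    ins p h (fun l => psi l (drop (m + p).-1 s)) (take (m + p).-1 s)
    + (-1) ^+ (p.+1 * m) *: ins p h (psi (take m s)) (drop m s).
Proof.
elim: m psi s => [|m IH] psi s psi0.
  (* An insertion is never the empty list, the only one on which psi lives. *)
  have z r l : ins p h (fun l => psi l r) l = 0.
    elim: l r {s} => [|x t _] r /=; first by rewrite psi0.
    rewrite psi0 // add0r -[RHS](scaler0 _ ((-1) ^+ p.+1)); congr (_ *: _).
    rewrite -[RHS](ins_zero_phi p h t); apply: eq_ins => l.
    by rewrite /fix_head psi0.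
  rewrite z add0r muln0 expr0 scale1r take0 drop0.
  by apply: eq_ins => l; rewrite take0 drop0.
case: s => [|x t] /=; first by rewrite [psi [::] _]psi0 // scaler0 addr0.
have -> : fix_head (fun l => psi (take m.+1 l) (drop m.+1 l)) x =
  (fun l => psi (x :: take m l) (drop m l)) by [].
rewrite (IH (fun l r => psi (x :: l) r)); last first.
  by move=> l r sl; apply: psi0 => /= -[].
rewrite scalerDr scalerA -exprD -mulnS addrA; congr (_ + _).
(* If m + p = 0, the predecessor in the induction hypothesis is truncated. *)
have [mp0|mp_gt0] := posnP (m + p).
  move: mp0 psi0 => /eqP; rewrite addn_eq0 => /andP[/eqP-> /eqP->] psi0 /=.
  rewrite !addn0 !take0 /= [psi [:: x; _] _]psi0 //.
  by rewrite scaler0 addr0.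
case E: (m + p)%N mp_gt0 => [//|q] _ /=; congr (_ + _).
rewrite -[x :: take q t]/(take q.+1 (x :: t)) -[drop q t]/(drop q.+1 (x :: t)) -E.
by rewrite take_takel ?leq_addl // take_drop drop_drop.
Qed.

(** The insertions of g and h side by side, with g to the left of h. *)
Fixpoint ins_pair m g p h phi s {struct s} : A :=
  (-1) ^+ (p.+1 * m) *: ins p h (fix_head phi (g (take m s))) (drop m s)
  + (if s is x :: t then (-1) ^+ (m + p) *: ins_pair m g p h (fix_head phi x) t else 0).

Lemma sign_or n : (-1) ^+ n = 1 :> k \/ (-1) ^+ n = -1 :> k.
Proof. by rewrite -signr_odd; case: odd; [right | left]. Qed.

Lemma eq_sign (i j : nat) : odd i = odd j -> (-1) ^+ i = (-1) ^+ j :> k.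
Proof. by move=> ij; rewrite -signr_odd ij signr_odd. Qed.

Lemma ins_head m p g h phi s : homogeneous m g -> multilinear phi ->
  ins p h (fun l => phi (g (take m l) :: drop m l)) s =
    phi (ins p h g (take (m + p).-1 s) :: drop (m + p).-1 s)
    + (-1) ^+ (p.+1 * m) *: ins p h (fix_head phi (g (take m s))) (drop m s).
Proof.
move=> g0 phil; rewrite (ins_split _ _ (psi := fun l r => phi (g l :: r))).
  by rewrite ins_post // => c x y; apply: multilinear_head.
by move=> l r /g0 ->; apply: (multilinear0 [::]).
Qed.

(** The three terms collect the insertions of h into g, of h to the right of g,
    and of h to the left of g.  In the last case h has shifted the position of g
    by p - 1, whence the sign relative to [ins_pair]. *)
Lemma ins_ins m g p h phi s :
  homogeneous m g -> multilinear phi -> (0 < m + p)%N ->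
  ins p h (ins m g phi) s =
    ins (m + p).-1 (ins p h g) phi s + ins_pair m g p h phi s
    + (-1) ^+ (m.+1 * p.+1) *: ins_pair p h m g phi s.
Proof.
move=> g0 + mp.
have e1 : odd (m.+1 * p.+1 + m.+1 * p) = odd m.+1 by lia.
elim: s phi => [|x t IH] phi phil.
  have := ins_head p h [::] g0 phil; rewrite /= => ->.
  by rewrite !addr0 scalerA -exprD (eq_sign e1).
have := ins_head p h (x :: t) g0 phil; rewrite [LHS]/= => C.
rewrite [LHS]/=.
pose hd l := phi (g (take m l) :: drop m l).
have -> : fix_head (ins m g phi) x =
    (-1) ^+ m.+1 *: ins m g (fix_head phi x) + fix_head hd x.
  by apply/funext => l; rewrite addrC.
rewrite ins_linphi IH; last exact: multilinear_fix_head.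
rewrite [RHS]/=.
have e3 : odd (m + p).-1.+1 = odd (m.+1 + p.+1) by lia.
have e4 : odd (p + m) = odd (m.+1 + p.+1) by lia.
have e5 : odd (m + p) = odd (m.+1 + p.+1) by lia.
rewrite (eq_sign e3) (eq_sign e4) (eq_sign e5).
rewrite -[fix_head (fun l => _) x]/(fix_head hd x) in C.
have -> : phi (g (take m (h (take p (x :: t)) :: drop p (x :: t)))
    :: drop m (h (take p (x :: t)) :: drop p (x :: t))) = 
  phi (ins p h g (take (m + p).-1 (x :: t)) :: drop (m + p).-1 (x :: t))
  + (-1) ^+ (p.+1 * m) *: ins p h (fix_head phi (g (take m (x :: t)))) (drop m (x :: t))
  - (-1) ^+ p.+1 *: ins p h (fix_head hd x) t.
  by rewrite -C addrK.
rewrite [X in _ = _ + X]scalerDr scalerA -[in X in _ = _ + X]exprD (eq_sign e1) (exprD _ m.+1).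
module_coef.
Qed.

Lemma insE m g phi s :
  ins m g phi s = \sum_(i < (size s).+1)
    (-1) ^+ (i * m.+1) *: phi (take i s ++ g (take m (drop i s)) :: drop (i + m) s).
Proof.
elim: s phi => [|x t IH] phi; first by rewrite big_ord1 /= scale1r.
rewrite big_ord_recl scale1r /= IH scaler_sumr; congr (_ + _).
by apply: eq_bigr => i _; rewrite /bump /= add1n mulSn exprD scalerA.
Qed.

(** Past this position fewer than m arguments are left for g, which therefore
    vanishes. *)
Lemma ins_short m g phi s i : homogeneous m g -> multilinear phi ->
  (i <= size s < i + m)%N ->
  phi (take i s ++ g (take m (drop i s)) :: drop (i + m) s) = 0.
Proof.
move=> g0 phil /andP[le_i lt_s]; rewrite g0 ?multilinear0 // size_take_min size_drop; lia.
Qed.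

Lemma homogeneous_ins n m g phi : homogeneous n phi -> homogeneous m g ->
  multilinear phi -> (0 < n + m)%N -> homogeneous (n + m).-1 (ins m g phi).
Proof.
move=> phi0 g0 phil nm s sz; rewrite insE big1 // => i _.
have [le_m|lt_m] := leqP (i + m) (size s); last first.
  by rewrite ins_short ?scaler0 // -ltnS ltn_ord.
rewrite phi0 ?scaler0 // size_cat size_take_min /= size_drop.
by move: (ltn_ord i); lia.
Qed.

Lemma multilinear_ins m g phi :
  multilinear phi -> multilinear g -> multilinear (ins m g phi).
Proof.
move=> phil gl s t c x y.
have hd psi r (l := fun u => psi (g (take m (r ++ u :: t)) :: drop m (r ++ u :: t))) :
    multilinear psi -> l (c *: x + y) = c *: l x + l y.
  move=> psil; rewrite {}/l; have [lt_r|le_r] := ltnP (size r) m; last first.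
    rewrite !takel_cat // !drop_cat; case: ltnP => _; first exact: (psil (_ :: _)).
    by move: le_r; rewrite -subn_eq0 => /eqP ->; exact: (psil [:: _]).
  rewrite !take_cat !drop_cat !ltnNge (ltnW lt_r) /=.
  case E: (m - size r)%N => [|q]; first by move: lt_r; rewrite -subn_gt0 E.
  by rewrite /= gl multilinear_head.
elim: s phi phil => [|z s IH] phi phil /=; last first.
  rewrite (hd _ (z :: s)) // IH /=; last exact: multilinear_fix_head.
  by module_coef.
rewrite (hd _ [::]) // !cat0s.
have -> : fix_head phi (c *: x + y) = c *: fix_head phi x + fix_head phi y.
  by apply/funext => l; apply: multilinear_head.
by rewrite ins_linphi; module_coef.
Qed.

Lemma gcircE n m f g : homogeneous n.+1 f -> homogeneous m.+1 g -> multilinear f ->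
  gcirc n.+1 m.+1 f g = ins m.+1 g f.
Proof.
move=> f0 g0 fl; apply/funext => s; rewrite /gcirc.
case: eqP => [sz|sz]; last by rewrite (@homogeneous_ins n.+1 m.+1).
rewrite insE; have -> : (size s).+1 = (n.+1 + m.+1)%N by rewrite sz.
rewrite big_split_ord /= [X in _ = _ + X]big1 ?addr0 => [|i _].
  by apply: eq_bigr => i _; rewrite (@eq_sign (i * m) (i * m.+2)) //; lia.
by rewrite ins_short ?scaler0 //; move: (ltn_ord i); lia.
Qed.

(** By [ins_ins] the associator of f, g, h consists of the side by side
    insertions, on which exchanging g and h has the effect of the sign. *)
Lemma pre_lie n m p f g h s :
  hcochain n f -> hcochain m g -> hcochain p h -> (0 < m + p)%N ->
  ins p h (ins m g f) s = ins (m + p).-1 (ins p h g) f s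
    + (-1) ^+ (m.+1 * p.+1) *: (ins m g (ins p h f) s - ins (m + p).-1 (ins m g h) f s).
Proof.
move=> /hcochainP[_ fl] /hcochainP[g0 _] /hcochainP[h0 _] mp.
have pm : (0 < p + m)%N by rewrite addnC.
rewrite !ins_ins // [(p + m)%N]addnC [(p.+1 * _)%N]mulnC.
by case: (sign_or (m.+1 * p.+1)) => ->; module_coef.
Qed.

(** The Gerstenhaber bracket ([gbracketE]), with signs that are also correct in
    degree 0. *)
Definition lie n m f g : seq A -> A :=
  ins m g f - (-1) ^+ (n.+1 * m.+1) *: ins n f g.

Lemma lieE n m f g s :
  lie n m f g s = ins m g f s - (-1) ^+ (n.+1 * m.+1) *: ins n f g s.
Proof. by []. Qed.

Lemma gbracketE n m f g : hcochain n.+1 f -> hcochain m.+1 g ->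
  gbracket n.+1 m.+1 f g = lie n.+1 m.+1 f g.
Proof.
move=> /hcochainP[f0 fl] /hcochainP[g0 gl].
by rewrite /gbracket !gcircE // /lie (@eq_sign (n * m) (n.+2 * m.+2)) //; lia.
Qed.

Lemma hcochain_ins n m f g : hcochain n f -> hcochain m g -> (0 < n + m)%N ->
  hcochain (n + m).-1 (ins m g f).
Proof.
move=> /hcochainP[f0 fl] /hcochainP[g0 gl] nm; apply/hcochainP.
by split; [apply: homogeneous_ins | apply: multilinear_ins].
Qed.

Lemma hcochain_lin n c f g : hcochain n f -> hcochain n g -> hcochain n (c *: f + g).
Proof.
move=> [f0 fl] [g0 gl]; split=> [s sz|s t d x y sz].
  by rewrite -[LHS]/(c *: f s + g s) f0 // g0 // scaler0 addr0.
rewrite -![(c *: f + g) _]/(c *: f _ + g _) fl // gl //; module_coef.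
Qed.

Lemma hcochain0 n : hcochain n (0 : seq A -> A).
Proof. by split=> // s t c x y _; rewrite scaler0 addr0. Qed.

Lemma hcochain_lie n m f g : hcochain n f -> hcochain m g -> (0 < n + m)%N ->
  hcochain (n + m).-1 (lie n m f g).
Proof.
move=> fn gm nm; rewrite /lie addrC -scaleNr; apply: hcochain_lin.
  by rewrite addnC; apply: hcochain_ins; rewrite // addnC.
exact: hcochain_ins.
Qed.

(** The graded Jacobi identity, as the statement that the bracket with h is a
    derivation.  Expanding all brackets, the difference of the two sides is the
    combination of three instances of [pre_lie]. *)
Lemma lie_leibniz n m p f g h :
  hcochain n f -> hcochain m g -> hcochain p h ->
  (0 < n + m)%N -> (0 < m + p)%N -> (0 < n + p)%N ->
  lie (n + m).-1 p (lie n m f g) h =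
    lie n (m + p).-1 f (lie m p g h)
    + (-1) ^+ (m.+1 * p.+1) *: lie (n + p).-1 m (lie n p f h) g.
Proof.
move=> fn gm hp nm mp np; apply/funext => s.
have mn : (0 < m + n)%N by rewrite addnC.
rewrite -[RHS]/(lie n (m + p).-1 f (lie m p g h) s
   + (-1) ^+ (m.+1 * p.+1) *: lie (n + p).-1 m (lie n p f h) g s) !lieE.
have fl := (hcochainP n f).1 fn; have gl := (hcochainP m g).1 gm.
have hl := (hcochainP p h).1 hp.
have subl q u v w w' c : ins q u (w - c *: w') v = ins q u w v - c *: ins q u w' v.
  by rewrite -!scaleNr [w + _]addrC ins_linphi addrC.
have subr q u u' w v c : multilinear w ->
    ins q (u - c *: u') w v = ins q u w v - c *: ins q u' w v.
  by move=> wl; rewrite -!scaleNr [u + _]addrC ins_lin // addrC.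
rewrite !(subl, subr); try tauto.
rewrite (pre_lie s fn gm hp) // (pre_lie s gm fn hp) // (pre_lie s hp fn gm) //.
have parity q r u : (0 < q + r)%N -> (-1) ^+ ((q + r).-1.+1 * u) =
    (-1) ^+ (q.+1 * u) * (-1) ^+ (r.+1 * u) :> k.
  move=> qr; rewrite prednK // -exprD; apply: eq_sign.
  by rewrite !(oddD, oddM) /=; case: (odd q); case: (odd r); case: (odd u).
rewrite [(n.+1 * (m + p).-1.+1)%N]mulnC !parity // [(n.+1 * m.+1)%N]mulnC.
rewrite [(p.+1 * m.+1)%N]mulnC [(p.+1 * n.+1)%N]mulnC.
case: (sign_or (m.+1 * n.+1)) => ->; case: (sign_or (m.+1 * p.+1)) => ->;
  case: (sign_or (n.+1 * p.+1)) => ->; module_coef.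
Qed.

Lemma lie_linl n m c f f' g : hcochain m g ->
  lie n m (c *: f + f') g = c *: lie n m f g + lie n m f' g.
Proof.
move=> /hcochainP[_ gl]; apply/funext => s.
rewrite -[RHS]/(c *: lie n m f g s + lie n m f' g s) !lieE ins_linphi ins_lin //.
by module_coef.
Qed.

Lemma lie_antisym n m f g :
  lie n m f g = - ((-1) ^+ (n.+1 * m.+1) *: lie m n g f).
Proof.
apply/funext => s; rewrite -[RHS]/(- (_ *: lie m n g f s)) !lieE [(m.+1 * _)%N]mulnC.
by case: (sign_or (n.+1 * m.+1)) => ->; module_coef.
Qed.

Lemma lie_linr n m c f g g' : hcochain n f ->
  lie n m f (c *: g + g') = c *: lie n m f g + lie n m f g'.
Proof.
move=> fn; rewrite lie_antisym lie_linl // !(lie_antisym n m f).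
by module_coef.
Qed.

Lemma lie0l n m g : hcochain m g -> lie n m 0 g = 0.
Proof.
move=> gm; have := lie_linl n (-1) 0 0 gm.
by rewrite scaler0 addr0 scaleN1r addNr.
Qed.

Lemma lie0r n m f : hcochain n f -> lie n m f 0 = 0.
Proof. by move=> fn; rewrite lie_antisym lie0l // scaler0 oppr0. Qed.

Lemma lieZl n m c f g : hcochain m g -> lie n m (c *: f) g = c *: lie n m f g.
Proof. by move=> gm; rewrite -[c *: f]addr0 lie_linl // lie0l // addr0. Qed.

Lemma gbracket_closed i j f g : hcochain i.+1 f -> hcochain j.+1 g ->
  hcochain (i + j).+1 (gbracket i.+1 j.+1 f g).
Proof. by move=> fi gj; rewrite gbracketE // -addnS; apply: hcochain_lie fi gj _. Qed.

Lemma graded_lie_cochains :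
  graded_lie (fun i => hcochain i.+1) (fun _ f => f = 0)
    (fun i j => @gbracket k A i.+1 j.+1).
Proof.
have sg i j : (-1) ^+ (i.+2 * j.+2) = (-1) ^+ (i * j) :> k.
  by apply: eq_sign; rewrite !oddM /= !negbK.
split=> [i|i|i x|i j x y|i j x y|i j x y|i j c x x' y|i j c x y y'|i j x y|i j l x y z].
- by split=> [|c x y xi yi]; [apply: hcochain0 | apply: hcochain_lin].
- by split=> // c x y -> ->; rewrite scaler0 addr0.
- by move=> ->; apply: hcochain0.
- exact: gbracket_closed.
- by move=> -> yj; rewrite gbracketE ?lie0l //; apply: hcochain0.
- by move=> xi ->; rewrite gbracketE ?lie0r //; apply: hcochain0.
- move=> xi xi' yj; rewrite !gbracketE ?lie_linl ?subrr //; exact: hcochain_lin.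
- move=> xi yj yj'; rewrite !gbracketE ?lie_linr ?subrr //; exact: hcochain_lin.
- by move=> xi yj; rewrite !gbracketE // lie_antisym sg addNr.
move=> xi yj zl.
have xy := gbracket_closed xi yj; have yz := gbracket_closed yj zl.
have zx := gbracket_closed zl xi.
rewrite gbracketE // [X in _ + _ *: X + _]gbracketE //.
rewrite [X in _ + _ *: X]gbracketE // !gbracketE //.
have := lie_leibniz xi yj zl isT isT isT.
rewrite !addSn !addnS /= => leib.
(* Antisymmetry brings all three terms to the shape they have in [leib]. *)
rewrite (lie_antisym j.+1 (l + i).+1) (lie_antisym l.+1 (i + j).+1) (lie_antisym l.+1 i.+1).
rewrite -!scaleNr lieZl // [(l + i)%N]addnC leib !sg.
have par q r u : (-1) ^+ (q * (r + u)) = (-1) ^+ (q * r) * (-1) ^+ (q * u) :> k.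
  by rewrite mulnDr exprD.
rewrite !par [(j * i)%N]mulnC [(l * i)%N]mulnC [(l * j)%N]mulnC.
case: (sign_or (i * j)) => ->; case: (sign_or (i * l)) => ->;
  case: (sign_or (j * l)) => ->; module_coef.
Qed.

End Insertion.

(** * The Hochschild differential as a bracket *)

Section Differential.
Variables (k : fieldType) (A : lmodType k) (mul : A -> A -> A).
Hypothesis mulA : associative mul.
Hypothesis mul_linl : forall c x y z, mul (c *: x + y) z = c *: mul x z + mul y z.
Hypothesis mul_linr : forall c x y z, mul x (c *: y + z) = c *: mul x y + mul x z.
Implicit Types (f g h phi psi : seq A -> A) (s t : seq A).

Definition mul2 s : A := if s is [:: x; y] then mul x y else 0.

Lemma hcochain_mul2 : hcochain 2 mul2.
Proof.
apply/hcochainP; split=> [[|x [|y []]] //|s t c x y].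
by case: s => [|z [|w [|? ?]]]; case: t => [|v [|u t]] //=; rewrite ?scaler0 ?addr0 //.
Qed.

Lemma ins_mul2_mul2 : ins 2 mul2 mul2 = 0.
Proof.
have [mul20 mul2l] := (hcochainP _ _).1 hcochain_mul2.
apply/funext => s; have [sz|sz] := eqVneq (size s) 3; last first.
  by apply: (@homogeneous_ins _ _ 2 2) => //; apply/eqP.
case: s sz => [|x [|y [|z []]]] //= _; rewrite /fix_head /=.
by rewrite mulA -[RHS]/(0 : A); module_coef.
Qed.

(** The two outer terms of the differential insert f into the multiplication,
    the inner ones insert the multiplication into f. *)
Lemma hdiffE n f : hcochain n f -> hdiff mul n f = - lie n 2 f mul2.
Proof.
move=> /hcochainP[f0 fl]; have [mul20 mul2l] := (hcochainP _ _).1 hcochain_mul2.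
apply/funext => s; rewrite /hdiff -[RHS]/(- lie n 2 f mul2 s) lieE.
case: eqP => [sz|sz]; last first.
  rewrite [ins n f mul2 s](@homogeneous_ins _ _ 2 n) //.
  by rewrite [ins 2 mul2 f s](@homogeneous_ins _ _ n 2) // ?addn2 // scaler0 subr0 oppr0.
rewrite !insE sz.
have -> : \sum_(i < n.+2) (-1) ^+ (i * 3) *:
      f (take i s ++ mul2 (take 2 (drop i s)) :: drop (i + 2) s) =
    \sum_(i < n) (-1) ^+ i *: f (take i s ++ mul s`_i s`_i.+1 :: drop i.+2 s).
  rewrite !big_ord_recr /= !ins_short ?sz ?scaler0 ?addr0 //; try lia.
  apply: eq_bigr => i _; rewrite addn2 (@eq_sign _ (i * 3) i); last by rewrite oddM andbT.
  have lt_i := ltn_ord i; have lt1 : (i < size s)%N by lia.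
  have lt2 : (i.+1 < size s)%N by lia.
  by rewrite (drop_nth 0 lt1) (drop_nth 0 lt2) /= take0.
have -> : \sum_(i < n.+2) (-1) ^+ (i * n.+1) *:
      mul2 (take i s ++ f (take n (drop i s)) :: drop (i + n) s) =
    mul (f (take n s)) s`_n + (-1) ^+ n.+1 *: mul s`_0 (f (behead s)).
  rewrite !big_ord_recl big1 ?addr0 => [|i _]; last first.
    rewrite ins_short ?scaler0 //= sz /bump /=; move: (ltn_ord i); lia.
  have lt_n : (n < size s)%N by rewrite sz.
  rewrite /= scale1r drop0 (drop_nth 0 lt_n) (@drop_oversize _ n.+1) ?sz //.
  case: s sz lt_n => [//|x t] [sz] _ /=.
  by rewrite drop0 [take n t]take_oversize ?sz // take0 mul1n.
have -> : \sum_(i < n) (-1) ^+ i.+1 *: f (take i s ++ mul s`_i s`_i.+1 :: drop i.+2 s) =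
    - \sum_(i < n) (-1) ^+ i *: f (take i s ++ mul s`_i s`_i.+1 :: drop i.+2 s).
  by rewrite -sumrN; apply: eq_bigr => i _; rewrite exprS -scalerA scaleN1r.
rewrite (@eq_sign _ (n.+1 * 3) n.+1) ?oddM ?andbT //.
by case: (sign_or k n.+1) => ->; module_coef.
Qed.

(** The Jacobi identity would only give that twice the left-hand side vanishes,
    which says nothing in characteristic 2.  Instead, [ins_ins] is applied to two
    insertions of the multiplication: the nested ones vanish by associativity,
    and the side by side ones cancel as the multiplication has odd Lie
    degree.  By [pre_lie] and associativity the other terms cancel as well. *)
Lemma lie_mul2_sq n f : hcochain n f -> lie n.+1 2 (lie n 2 f mul2) mul2 = 0.
Proof.
move=> fn; have [f0 fl] := (hcochainP _ _).1 fn.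
have m2 := hcochain_mul2.
have [mul20 mul2l] := (hcochainP _ _).1 hcochain_mul2.
have -> : lie n 2 f mul2 = - (-1) ^+ (n.+1 * 3) *: ins n f mul2 + ins 2 mul2 f.
  by rewrite /lie scaleNr addrC.
have n2 : (0 < n + 2)%N by rewrite addn2.
apply/funext => s; rewrite lieE ins_linphi ins_lin //.
rewrite (ins_ins _ _ mul20) // (pre_lie s m2 fn m2) // ins_mul2_mul2 ins_zero_phi ins_zero //.
have e : odd (n.+2 * 3) = odd n by rewrite oddM andbT /= negbK.
rewrite addn2 -[RHS]/(0 : A) /= (eq_sign _ e).
rewrite (@eq_sign _ (n.+1 * 3) n.+1) ?oddM ?andbT //.
rewrite (@eq_sign _ (3 * 3) 1) // exprS.
by case: (sign_or k n) => ->; module_coef.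
Qed.

Lemma hdiff_lin n c f g : hcochain n f -> hcochain n g ->
  hdiff mul n (c *: f + g) = c *: hdiff mul n f + hdiff mul n g.
Proof.
move=> fn gn; rewrite !hdiffE //; last exact: hcochain_lin.
by rewrite lie_linl; [module_coef | exact: hcochain_mul2].
Qed.

Lemma hdiff0 n : hdiff mul n 0 = 0.
Proof.
have f0 := hcochain0 A n.
by rewrite hdiffE // lie0l ?oppr0 //; exact: hcochain_mul2.
Qed.

Lemma hdiffZ n c f : hcochain n f -> hdiff mul n (c *: f) = c *: hdiff mul n f.
Proof.
by move=> fn; have := hdiff_lin c fn (hcochain0 A n); rewrite hdiff0 !addr0.
Qed.

Lemma hcochain_hdiff n f : hcochain n f -> hcochain n.+1 (hdiff mul n f).
Proof.
move=> fn; rewrite hdiffE // -scaleN1r -[_ *: _]addr0.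
apply: hcochain_lin; last exact: hcochain0.
by have := hcochain_lie fn hcochain_mul2; rewrite addn2; apply.
Qed.

Lemma hdiff_hdiff n f : hcochain n f -> hdiff mul n.+1 (hdiff mul n f) = 0.
Proof.
move=> fn; rewrite hdiffE; last exact: hcochain_hdiff.
rewrite hdiffE // -[- lie n 2 f _]scaleN1r lieZl; last exact: hcochain_mul2.
by rewrite lie_mul2_sq // scaler0 oppr0.
Qed.

Let Z i := cocycle (@hcochain k A) (hdiff mul) i.+1.
Let B i := coboundary (@hcochain k A) (hdiff mul) i.+1.

Lemma submodule_coboundary i : submodule (B i).
Proof.
split=> [|c x y [f fi ->] [g gi ->]].
  by exists 0; [exact: hcochain0 | rewrite hdiff0].
by exists (c *: f + g); [apply: hcochain_lin | rewrite hdiff_lin].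
Qed.

(** This is [lie_leibniz] for the bracket with the multiplication; brackets of
    cocycles are thus cocycles, and brackets of cocycles with coboundaries are
    coboundaries. *)
Lemma hdiff_lie n m f g : hcochain n f -> hcochain m g -> (0 < n + m)%N ->
  hdiff mul (n + m).-1 (lie n m f g) =
    lie n m.+1 f (hdiff mul m g) + (-1) ^+ m.+1 *: lie n.+1 m (hdiff mul n f) g.
Proof.
move=> fn gm nm; have m2 := hcochain_mul2.
rewrite hdiffE; last exact: hcochain_lie.
rewrite (lie_leibniz fn gm m2) ?addn2 //= !hdiffE //.
rewrite -[- lie m 2 _ _]scaleN1r -[_ *: lie m 2 _ _]addr0 lie_linr // lie0r //.
rewrite -[- lie n 2 _ _]scaleN1r lieZl //.
rewrite (@eq_sign _ (m.+1 * 3) m.+1) ?oddM ?andbT //.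
by case: (sign_or k m.+1) => ->; module_coef.
Qed.

Lemma graded_lie_cohomology : graded_lie Z B (fun i j => @gbracket k A i.+1 j.+1).
Proof.
have GL := graded_lie_cochains A.
have B0 i : B i 0 by case: (submodule_coboundary i).
have BZ i c f : B i f -> B i (c *: f).
  by move=> Bf; rewrite -[_ *: _]addr0; apply: (submodule_coboundary i).2.
have ideall i j x y : B i x -> Z j y -> B (i + j)%N (gbracket i.+1 j.+1 x y).
  move=> [f fi ->] [yj dy]; have dfi := hcochain_hdiff fi.
  rewrite gbracketE //; have fy : hcochain (i + j) (lie i j.+1 f y).
    by have := hcochain_lie fi yj; rewrite addnS; apply.
  exists ((-1) ^+ j *: lie i j.+1 f y).
    by rewrite -[_ *: _]addr0; apply: hcochain_lin => //; exact: hcochain0.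
  rewrite hdiffZ //; have := hdiff_lie fi yj; rewrite addnS /= => -> //.
  rewrite dy lie0r // exprS exprS; case: (sign_or k j) => ->; module_coef.
split=> [i|i|i x|i j x y|i j x y|i j x y|i j c x x' y|i j c x y y'|i j x y|i j l x y z].
- split=> [|c x y [xi dx] [yi dy]].
    by split; [apply: hcochain0 | apply: hdiff0].
  by split; [apply: hcochain_lin | rewrite hdiff_lin // dx dy scaler0 addr0].
- exact: submodule_coboundary.
- by move=> [f fi ->]; split; [apply: hcochain_hdiff | apply: hdiff_hdiff].
- move=> [xi dx] [yj dy]; split; first exact: gbracket_closed.
  have := hdiff_lie xi yj; rewrite addSn addnS /= gbracketE // => -> //.
  by rewrite dx dy lie0r // lie0l // scaler0 addr0.
- exact: ideall.
- move=> Zx By; have [y' y'j ey] := By; have := ideall _ _ _ _ By Zx.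
  case: Zx => xi _; have yj : hcochain j.+1 y by rewrite ey; apply: hcochain_hdiff.
  rewrite !gbracketE // addnC => Byx; rewrite lie_antisym -scaleNr; exact: BZ.
- by move=> [xi _] [xi' _] [yj _]; rewrite (gl_linl GL).
- by move=> [xi _] [yj _] [yj' _]; rewrite (gl_linr GL).
- by move=> [xi _] [yj _]; rewrite (gl_antisym GL).
by move=> [xi _] [yj _] [zl _]; rewrite (gl_jacobi GL).
Qed.

End Differential.

(** * Coordinates in a radical square zero path algebra *)

Section RadicalSquareZero.
Variables (k : fieldType) (Q : quiver).
Local Notation A := (radsq0 k Q).
Local Notation kQ := (path_alg k Q).
Implicit Types (p q : qpath Q) (u t : A) (a b : arr Q) (v w : vert Q).

Lemma freeg_lin_ind (K : choiceType) (P : {freeg K / k} -> Prop) x :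
  P 0 -> (forall c x y, P x -> P y -> P (c *: x + y)) ->
  (forall z : K, z \in dom x -> P << z >>) -> P x.
Proof.
move=> P0 Pl Px; rewrite -[x]freeg_sumE big_seq; elim/big_ind: _ => //.
  by move=> y z Py Pz; rewrite -[y]scale1r; apply: Pl.
move=> z /Px Pz; have -> : << coeff z x *g z >> = coeff z x *: << z >> + 0.
  by rewrite addr0; apply/eqP/freeg_eqP => t; rewrite coeffZ !coeffU mul1r.
exact: Pl.
Qed.

Lemma plen_cat p q r : pcat p q = Some r -> plen r = (plen p + plen q)%N.
Proof.
case: (boolP (composable p q)) => [pq|/pcatN -> //].
have [r' -> rE] := pcatP pq => -[<-].
by rewrite /plen /arrows rE /= size_cat.
Qed.

Definition long_supported (x : kQ) : Prop := forall p, (plen p <= 1)%N -> coeff p x = 0.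

Lemma long_supported_ind (P : kQ -> Prop) x :
  P 0 -> (forall c x y, P x -> P y -> P (c *: x + y)) ->
  (forall p, (1 < plen p)%N -> P (path_elt k p)) -> long_supported x -> P x.
Proof.
move=> P0 Pl Pp xl; apply: freeg_lin_ind => // p; rewrite mem_dom => xp.
by apply: Pp; rewrite ltnNge; apply: contra xp => /xl ->.
Qed.

Lemma long_supported_path p : (1 < plen p)%N -> long_supported (path_elt k p).
Proof.
move=> lp q lq; rewrite coeffU; case: eqP => [pq|_]; last by rewrite mulr0.
by move: lp; rewrite pq ltnNge lq.
Qed.

Lemma long_supported_lin c (x y : kQ) : long_supported x -> long_supported y ->
  long_supported (c *: x + y).
Proof. by move=> xl yl p lp; rewrite coeffD coeffZ xl // yl // mulr0 addr0. Qed.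

Lemma long_supported0 : long_supported 0.
Proof. by move=> p _; rewrite coeff0. Qed.

Lemma path_eltM p q : path_elt k p * path_elt k q = opath_elt k (pcat p q).
Proof. exact: pa_mulE. Qed.

(** The elements supported on paths of length at least two form an ideal that
    contains the paths of length two.  Coordinates on shorter paths are therefore
    well defined modulo the ideal which the latter generate. *)
Lemma coeff_gen_ideal (x : kQ) : x \in gen_ideal (@path_of_length2 k Q) -> long_supported x.
Proof.
move=> /gen_idealP; apply=> [|s [p p2 ->]]; last by apply: long_supported_path; rewrite p2.
split=> [|y z yl zl|y z zl|z y yl].
- exact: long_supported0.
- by rewrite addrC -scaleN1r; apply: long_supported_lin.
- apply: (@long_supported_ind (fun z : kQ => long_supported (y * z)) z) => // [|c z1 z2 l1 l2|q lq].
  + by rewrite mulr0; apply: long_supported0.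
  + by rewrite mulrDr -pa_scaleAr; apply: long_supported_lin.
  apply: (freeg_lin_ind (P := fun y : kQ => long_supported (y * path_elt k q)) (x := y)).
  + by rewrite mul0r; apply: long_supported0.
  + by move=> c y1 y2 l1 l2; rewrite mulrDl -pa_scaleAl; apply: long_supported_lin.
  move=> p _; rewrite -/(path_elt k p) path_eltM; case E: pcat => [r|]; last exact: long_supported0.
  by apply: long_supported_path; rewrite (plen_cat E); apply: leq_trans lq (leq_addl _ _).
apply: (@long_supported_ind (fun y : kQ => long_supported (y * z)) y) => // [|c y1 y2 l1 l2|p lp].
- by rewrite mul0r; apply: long_supported0.
- by rewrite mulrDl -pa_scaleAl; apply: long_supported_lin.
apply: (freeg_lin_ind (P := fun z : kQ => long_supported (path_elt k p * z)) (x := z)).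
- by rewrite mulr0; apply: long_supported0.
- by move=> c y1 y2 l1 l2; rewrite mulrDr -pa_scaleAr; apply: long_supported_lin.
move=> q _; rewrite -/(path_elt k q) path_eltM; case E: pcat => [r|]; last exact: long_supported0.
by apply: long_supported_path; rewrite (plen_cat E); apply: leq_trans lp (leq_addr _ _).
Qed.

Lemma rs_coef_proj p (x : kQ) : (plen p <= 1)%N -> rs_coef p (qproj _ x) = coeff p x.
Proof.
move=> lp; apply/eqP; rewrite -subr_eq0 -coeffB; apply/eqP.
by apply: coeff_gen_ideal lp; apply: qproj_repr.
Qed.

Lemma rs_coef_lin p c u t : (plen p <= 1)%N ->
  rs_coef p (c *: u + t) = c * rs_coef p u + rs_coef p t.
Proof.
move=> lp; rewrite -[in LHS](qreprK u) -[in LHS](qreprK t).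
rewrite -[c *: _]/(rs_scale c _) -qprojZ -qprojD rs_coef_proj //.
by rewrite coeffD coeffZ.
Qed.

Lemma rs_coef_path p q : (plen p <= 1)%N -> rs_coef p (rs_path k q) = (q == p)%:R.
Proof. by move=> lp; rewrite rs_coef_proj // coeffU mul1r. Qed.

Lemma qproj_lin c (x y : kQ) :
  qproj (@path_of_length2 k Q) (c *: x + y) = c *: (qproj _ x : A) + qproj _ y.
Proof. by rewrite qprojD qprojZ. Qed.

Lemma qproj0 : qproj (@path_of_length2 k Q) 0 = 0.
Proof. by apply: (addrI (qproj _ 0)); rewrite -qprojD !addr0. Qed.

Lemma rs_pathM p q :
  rs_path k p * rs_path k q = if pcat p q is Some r then rs_path k r else 0.
Proof.
rewrite -[LHS]/(qmul _ _) /rs_path -qprojM path_eltM; case: pcat => //.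
exact: qproj0.
Qed.

Lemma rs_path_long p : (1 < plen p)%N -> rs_path k p = 0 :> A.
Proof.
case: p => [[v [|a [|b s]]] pP] // _.
have /= /and3P[sa sb ws] := pP.
have w2 : walk v [:: a; b] by rewrite /= sa sb.
pose p2 := @QPath Q (v, [:: a; b]) w2; pose p' := @QPath Q (tgt b, s) ws.
have [|r rE re] := @pcatP Q p2 p'; first exact: eqxx.
have -> : QPath pP = r by apply: val_inj; rewrite /= re.
have := rs_pathM p2 p'; rewrite rE => <-.
have -> : rs_path k p2 = 0; last by rewrite mul0r.
rewrite -qproj0; apply/qprojP/gen_idealP => I _; apply; exists p2 => //.
by rewrite subr0.
Qed.

Lemma short_path p : (plen p <= 1)%N ->
  (exists v, p = trivial_path v) \/ (exists a, p = arrow_path a).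
Proof.
case: p => [[v [|a [|b s]]] pP] //= _; [left; exists v | right; exists a].
  exact: val_inj.
by apply: val_inj => /=; case/andP: pP => /= /eqP ->.
Qed.

Lemma rs_ind (P : A -> Prop) u :
  P 0 -> (forall c x y, P x -> P y -> P (c *: x + y)) ->
  (forall v, P (rs_path k (trivial_path v))) ->
  (forall a, P (rs_path k (arrow_path a))) -> P u.
Proof.
move=> P0 Pl Pv Pa; rewrite -(qreprK u).
apply: (freeg_lin_ind (P := fun x : kQ => P (qproj _ x)) (x := qrepr u)).
- by rewrite qproj0.
- by move=> c x y Px Py; rewrite qproj_lin; apply: Pl.
move=> p _; rewrite -[qproj _ _]/(rs_path k p).
have [lp|/rs_path_long-> //] := leqP (plen p) 1.
by case: (short_path lp) => [[v ->]|[a ->]].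
Qed.

Lemma trivial_path_eq v w : (trivial_path v == trivial_path w) = (v == w).
Proof. by rewrite -val_eqE /= xpair_eqE eqxx andbT. Qed.

Lemma arrow_path_eq a b : (arrow_path a == arrow_path b) = (a == b).
Proof.
apply/eqP/eqP => [|-> //]; by move=> /(congr1 (@arrows Q)) [].
Qed.

Lemma arrow_trivial_path_eq a v : (arrow_path a == trivial_path v) = false.
Proof. by rewrite -val_eqE /= xpair_eqE andbF. Qed.

Lemma rs_coef_trivial_trivial v w :
  rs_coef (trivial_path v) (rs_path k (trivial_path w)) = (w == v)%:R.
Proof. by rewrite rs_coef_path // trivial_path_eq. Qed.

Lemma rs_coef_trivial_arrow v a :
  rs_coef (trivial_path v) (rs_path k (arrow_path a)) = 0.
Proof. by rewrite rs_coef_path // arrow_trivial_path_eq. Qed.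

Lemma rs_coef_arrow_trivial v a :
  rs_coef (arrow_path a) (rs_path k (trivial_path v)) = 0.
Proof. by rewrite rs_coef_path // eq_sym arrow_trivial_path_eq. Qed.

Lemma rs_coef_arrow_arrow a b :
  rs_coef (arrow_path a) (rs_path k (arrow_path b)) = (b == a)%:R.
Proof. by rewrite rs_coef_path // arrow_path_eq. Qed.

Definition rs_coefE := (rs_coef_trivial_trivial, rs_coef_trivial_arrow,
  rs_coef_arrow_trivial, rs_coef_arrow_arrow).

Lemma rs_coef0 p : (plen p <= 1)%N -> rs_coef p (0 : A) = 0.
Proof. by move=> lp; rewrite -qproj0 rs_coef_proj // coeff0. Qed.

Lemma rs_coefZ p c u : (plen p <= 1)%N -> rs_coef p (c *: u) = c * rs_coef p u.
Proof. by move=> lp; rewrite -[c *: u]addr0 rs_coef_lin // rs_coef0 // addr0. Qed.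

Lemma sum_delta (I : finType) (V : lmodType k) (i : I) (F : I -> V) :
  \sum_j (i == j)%:R *: F j = F i.
Proof.
rewrite (bigD1 i) //= eqxx scale1r big1 ?addr0 // => j.
by rewrite eq_sym => /negPf ->; rewrite scale0r.
Qed.

Lemma rs_decomp u :
  u = \sum_v rs_coef (trivial_path v) u *: rs_path k (trivial_path v)
    + \sum_a rs_coef (arrow_path a) u *: rs_path k (arrow_path a).
Proof.
elim/rs_ind: u => [|c x y ex ey|v|a].
- by rewrite !big1 ?addr0 // => i _; rewrite rs_coef0 // scale0r.
- rewrite {1}ex {1}ey scalerDr addrACA !scaler_sumr -!big_split /=.
  by congr (_ + _); apply: eq_bigr => i _; rewrite rs_coef_lin // scalerDl scalerA.
- rewrite [X in _ + X]big1 ?addr0 => [|a _]; last by rewrite rs_coefE scale0r.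
  by under eq_bigr do rewrite rs_coefE; rewrite sum_delta.
rewrite big1 ?add0r => [|v _]; last by rewrite rs_coefE scale0r.
by under eq_bigr do rewrite rs_coefE; rewrite sum_delta.
Qed.

Lemma rs_mul_vv v w : rs_path k (trivial_path v) * rs_path k (trivial_path w) =
  (v == w)%:R *: rs_path k (trivial_path w).
Proof.
rewrite rs_pathM pcat_trivl -[psrc _]/w; case: eqP => _; last by rewrite scale0r.
by rewrite scale1r.
Qed.

Lemma rs_mul_va v a : rs_path k (trivial_path v) * rs_path k (arrow_path a) =
  (src a == v)%:R *: rs_path k (arrow_path a).
Proof.
rewrite rs_pathM pcat_trivl -[psrc _]/(src a) eq_sym; case: eqP => _; last by rewrite scale0r.
by rewrite scale1r.
Qed.

Lemma rs_mul_av v a : rs_path k (arrow_path a) * rs_path k (trivial_path v) =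
  (tgt a == v)%:R *: rs_path k (arrow_path a).
Proof.
rewrite rs_pathM pcat_trivr -[pend _]/(tgt a); case: eqP => _; last by rewrite scale0r.
by rewrite scale1r.
Qed.

Lemma rs_mul_aa a b : rs_path k (arrow_path a) * rs_path k (arrow_path b) = 0 :> A.
Proof.
rewrite rs_pathM; case E: pcat => [r|] //; apply: rs_path_long.
by rewrite (plen_cat E).
Qed.

Lemma rs_mul_linl c u t (x : A) : (c *: u + t) * x = c *: (u * x) + t * x.
Proof. by rewrite mulrDl -rs_scaleAl. Qed.

Lemma rs_mul_linr c (x : A) u t : x * (c *: u + t) = c *: (x * u) + x * t.
Proof. by rewrite mulrDr -rs_scaleAr. Qed.

Lemma rs_mul_vl v u : rs_path k (trivial_path v) * u =
  rs_coef (trivial_path v) u *: rs_path k (trivial_path v) +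
  \sum_(a | src a == v) rs_coef (arrow_path a) u *: rs_path k (arrow_path a).
Proof.
rewrite {1}(rs_decomp u) mulrDr !mulr_sumr; congr (_ + _).
  rewrite (bigD1 v) //= -rs_scaleAr rs_mul_vv eqxx scale1r big1 ?addr0 // => w.
  by rewrite eq_sym -rs_scaleAr rs_mul_vv => /negPf ->; rewrite scale0r scaler0.
rewrite [RHS]big_mkcond; apply: eq_bigr => a _; rewrite -rs_scaleAr rs_mul_va.
by case: eqP => _; rewrite ?scale1r // scale0r scaler0.
Qed.

Lemma rs_mul_vr v u : u * rs_path k (trivial_path v) =
  rs_coef (trivial_path v) u *: rs_path k (trivial_path v) +
  \sum_(a | tgt a == v) rs_coef (arrow_path a) u *: rs_path k (arrow_path a).
Proof.
rewrite {1}(rs_decomp u) mulrDl !mulr_suml; congr (_ + _).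
  rewrite (bigD1 v) //= -rs_scaleAl rs_mul_vv eqxx scale1r big1 ?addr0 // => w.
  by rewrite -rs_scaleAl rs_mul_vv => /negPf ->; rewrite scale0r scaler0.
rewrite [RHS]big_mkcond; apply: eq_bigr => a _; rewrite -rs_scaleAl rs_mul_av.
by case: eqP => _; rewrite ?scale1r // scale0r scaler0.
Qed.

(** As products of arrows vanish, a occurs in a product only through
    e_(src a) a = a and a e_(tgt a) = a. *)
Lemma rs_coef_mul a u t : rs_coef (arrow_path a) (u * t) =
  rs_coef (trivial_path (src a)) u * rs_coef (arrow_path a) t
  + rs_coef (arrow_path a) u * rs_coef (trivial_path (tgt a)) t.
Proof.
elim/rs_ind: u t => [|c x y IHx IHy|v|b] t.
- by rewrite mul0r !rs_coef0 // !mul0r addr0.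
- by rewrite rs_mul_linl !rs_coef_lin // IHx IHy; ring.
- elim/rs_ind: t => [|c x y IHx IHy|w|b].
  + by rewrite mulr0 !rs_coef0 // !mulr0 addr0.
  + by rewrite rs_mul_linr !rs_coef_lin // IHx IHy; ring.
  + by rewrite rs_mul_vv rs_coefZ // !rs_coefE; ring.
  rewrite rs_mul_va rs_coefZ // !rs_coefE mul0r addr0.
  by case: (b =P a) => [->|_]; rewrite ?mulr0 // eq_sym.
- elim/rs_ind: t => [|c x y IHx IHy|w|b'].
  + by rewrite mulr0 !rs_coef0 // !mulr0 addr0.
  + by rewrite rs_mul_linr !rs_coef_lin // IHx IHy; ring.
  + rewrite rs_mul_av rs_coefZ // !rs_coefE mul0r add0r [RHS]mulrC.
    by case: (b =P a) => [->|_]; rewrite ?mulr0 // eq_sym.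
  by rewrite rs_mul_aa rs_coef0 // !rs_coefE mul0r mulr0 addr0.
Qed.

End RadicalSquareZero.

(** * A homotopy from the identity to the projection onto paths *)

Section LinearOperators.
Variables (k : fieldType) (A : lmodType k) (T : (seq A -> A) -> A).
Hypothesis Tl : linear T.

Lemma linop0 : T 0 = 0.
Proof. by have := Tl (-1) 0 0; rewrite scaler0 addr0 scaleN1r addNr. Qed.

Lemma linopN f : T (- f) = - T f.
Proof. by have := Tl (-1) f 0; rewrite linop0 !addr0 !scaleN1r. Qed.

Lemma linopD f g : T (f + g) = T f + T g.
Proof. by have := Tl 1 f g; rewrite !scale1r. Qed.

Lemma linopB f g : T (f - g) = T f - T g.
Proof. by rewrite linopD linopN. Qed.

Lemma linopZ c f : T (c *: f) = c *: T f.
Proof. by have := Tl c f 0; rewrite linop0 !addr0. Qed.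

Lemma linop_sum (I : Type) (r : seq I) (P : pred I) (c : I -> k) (F : I -> seq A -> A) :
  T (fun s => \sum_(i <- r | P i) c i *: F i s) = \sum_(i <- r | P i) c i *: T (F i).
Proof.
have -> : (fun s => \sum_(i <- r | P i) c i *: F i s) = \sum_(i <- r | P i) c i *: F i.
  by apply/funext => s; rewrite fct_sumE.
rewrite (big_morph T linopD linop0); apply: eq_bigr => i _.
exact: linopZ.
Qed.
End LinearOperators.

Section Homotopy.
Variables (k : fieldType) (Q : quiver).
Local Notation A := (radsq0 k Q).
Implicit Types (f g : seq A -> A) (s t : seq A) (x y : A) (a b : arr Q) (v w : vert Q).
Local Notation e v := (rs_path k (trivial_path v)).
Local Notation r a := (rs_path k (arrow_path a)).
Local Notation cV v := (rs_coef (trivial_path v)).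
Local Notation cA a := (rs_coef (arrow_path a)).

(** The arguments are projected onto the paths starting at v: the sum runs over
    these paths a_1 ... a_n, and g(a_1, ..., a_n) e' is weighted by the product
    of the coordinates of the arguments on the arrows ([walk_sumE]). *)
Fixpoint walk_sum v g s {struct s} : A :=
  if s is x :: t then
    \sum_(a | src a == v) cA a x *: walk_sum (tgt a) (fix_head g (r a)) t
  else g [::] * e v.

(** The Hochschild differential without its first term x_1 f(x_2, ..., x_(n+1));
    the first term is [left_diff] ([hdiff_right_diff]).  The remaining terms leave
    the left module structure of the values alone, and form a contractible
    complex ([right_diff_homotopy]). *)
Fixpoint right_diff f s {struct s} : A :=
  if s is x :: t then
    if t is y :: t' then - f (x * y :: t') - right_diff (fix_head f x) t
    else - (f [::] * x)
  else 0.

Lemma right_diff_nil f : right_diff f [::] = 0. Proof. by []. Qed.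
Lemma right_diff1 f x : right_diff f [:: x] = - (f [::] * x). Proof. by []. Qed.
Lemma right_diff_cons f x y t :
  right_diff f (x :: y :: t) = - f (x * y :: t) - right_diff (fix_head f x) (y :: t).
Proof. by []. Qed.
Lemma walk_sum_nil v g : walk_sum v g [::] = g [::] * e v. Proof. by []. Qed.
Lemma walk_sum_cons v g x t : walk_sum v g (x :: t) =
  \sum_(a | src a == v) cA a x *: walk_sum (tgt a) (fix_head g (r a)) t.
Proof. by []. Qed.
Arguments right_diff : simpl never.
Arguments walk_sum : simpl never.

(** The term i = 0 of the homotopy H. *)
Definition path_sum f s : A := \sum_v walk_sum v (fix_head f (e v)) s.

(** The operator H: once the first argument is fixed, the terms with i > 0 are
    those of the operator on the shorter list, with the opposite sign. *)
Fixpoint homotopy f s {struct s} : A :=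
  path_sum f s - (if s is x :: t then homotopy (fix_head f x) t else 0).

Lemma linear_walk_sum v s : linear (walk_sum v ^~ s).
Proof.
elim: s v => [|x t IH] v c f g; first exact: rs_mul_linl.
rewrite !walk_sum_cons scaler_sumr -big_split; apply: eq_bigr => a _ /=.
rewrite -[fix_head _ _]/(c *: fix_head f (r a) + fix_head g (r a)) IH.
by module_coef.
Qed.

Lemma linear_right_diff s : linear (right_diff ^~ s).
Proof.
elim: s => [|x [|y t] IH] c f g; first by rewrite !right_diff_nil scaler0 addr0.
  by rewrite !right_diff1 rs_mul_linl; module_coef.
rewrite !right_diff_cons -[fix_head _ x]/(c *: fix_head f x + fix_head g x) IH.
rewrite -[(c *: f + g) _]/(c *: f _ + g _); module_coef.
Qed.

Lemma linear_path_sum s : linear (path_sum ^~ s).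
Proof.
move=> c f g; rewrite /path_sum scaler_sumr -big_split; apply: eq_bigr => v _ /=.
exact: (linear_walk_sum v s c (fix_head f (e v)) (fix_head g (e v))).
Qed.

Lemma linear_homotopy s : linear (homotopy ^~ s).
Proof.
elim: s => [|x t IH] c f g /=; rewrite linear_path_sum; first by rewrite !subr0.
rewrite -[fix_head _ x]/(c *: fix_head f x + fix_head g x) IH; module_coef.
Qed.

Lemma walk_sum_right_diff_arrow w g a y t : multilinear g ->
  walk_sum w (fix_head (right_diff g) (r a)) (y :: t) =
  - walk_sum w (right_diff (fix_head g (r a))) (y :: t).
Proof.
move=> gl; rewrite !walk_sum_cons -sumrN; apply: eq_bigr => b _; rewrite -scalerN; congr (_ *: _).
rewrite -(linopN (linear_walk_sum _ _)); congr walk_sum; apply/funext => l.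
have g0 : g (0 :: l) = 0 by exact: (multilinear0 [::]).
by rewrite {1}/fix_head {1}/fix_head right_diff_cons rs_mul_aa g0 oppr0 add0r.
Qed.

(** By [rs_coef_mul], the coordinate of x_i x_(i+1) on an arrow a of a path is
    the sum of two products of a vertex coordinate and an arrow coordinate.
    Along a path the end of each arrow is the source of the next one, so these
    products cancel between neighbouring i, and at the right end with the
    vertex part of the last argument.  The vertex coordinate of the first
    argument is all that survives. *)
Lemma right_diff_walk_sum v g x t : multilinear g ->
  right_diff (walk_sum v g) (x :: t) = walk_sum v (right_diff g) (x :: t) - cV v x *: walk_sum v g t.
Proof.
elim: t x v g => [|y t IH] x v g gl.
  rewrite right_diff1 walk_sum_cons !walk_sum_nil -mulrA rs_mul_vl rs_mul_linr opprD addrC; congr (_ - _).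
  rewrite mulr_sumr -sumrN; apply: eq_bigr => a _.
  rewrite walk_sum_nil /fix_head right_diff1 mulNr -mulrA rs_mul_av eqxx scale1r -rs_scaleAr.
  by rewrite scalerN.
rewrite right_diff_cons !(walk_sum_cons v).
have -> : fix_head (walk_sum v g) x =
    fun l => \sum_(a | src a == v) cA a x *: walk_sum (tgt a) (fix_head g (r a)) l by [].
rewrite (linop_sum (linear_right_diff _)).
rewrite scaler_sumr -!sumrN -!big_split; apply: eq_bigr => a /eqP sa.
rewrite walk_sum_right_diff_arrow // IH; last exact: multilinear_fix_head.
rewrite /= rs_coef_mul sa; module_coef.
Qed.

Definition merge_head x f : seq A -> A :=
  fun s => if s is y :: t then f (x * y :: t) else 0.

(** The terms arise from the products next to the inserted idempotent e_v:
    e_v a = a on its right, x e_v on its left.  The last sum is the decomposition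
    of x e_v into its vertex part, which cancels what [right_diff_walk_sum] leaves
    over, and its arrow part, which cancels the terms from e_v a. *)
Lemma right_diff_path_sum f x t : multilinear f ->
  right_diff (path_sum f) (x :: t) + path_sum (right_diff f) (x :: t)
    + path_sum (merge_head x f) t = 0.
Proof.
move=> fl.
have -> : right_diff (path_sum f) (x :: t) =
    \sum_v walk_sum v (right_diff (fix_head f (e v))) (x :: t)
    - \sum_v cV v x *: walk_sum v (fix_head f (e v)) t.
  have -> : path_sum f = fun s => \sum_v 1 *: walk_sum v (fix_head f (e v)) s.
    by apply/funext => s; apply: eq_bigr => v _; rewrite scale1r.
  rewrite (linop_sum (linear_right_diff _)) -sumrB; apply: eq_bigr => v _.
  by rewrite scale1r right_diff_walk_sum //; exact: multilinear_fix_head.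
have -> : path_sum (right_diff f) (x :: t) =
    - \sum_a cA a x *: walk_sum (tgt a) (fix_head f (r a)) t
    - \sum_v walk_sum v (right_diff (fix_head f (e v))) (x :: t).
  rewrite (partition_big (@src Q) predT) //= -!sumrN -big_split; apply: eq_bigr => v _ /=.
  rewrite !walk_sum_cons -!sumrN -big_split /=; apply: eq_bigr => a /eqP sa.
  rewrite -!scalerN -scalerDr; congr (_ *: _).
  rewrite -!(linopN (linear_walk_sum _ _)) -(linopD (linear_walk_sum _ _)).
  congr walk_sum; apply/funext => l.
  rewrite {1}/fix_head {1}/fix_head right_diff_cons rs_mul_va sa eqxx scale1r.
  done.
have -> : path_sum (merge_head x f) t =
    \sum_v cV v x *: walk_sum v (fix_head f (e v)) t
    + \sum_a cA a x *: walk_sum (tgt a) (fix_head f (r a)) t.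
  rewrite [X in _ + X](partition_big (@tgt Q) predT) //= -big_split; apply: eq_bigr => v _ /=.
  have -> : fix_head (merge_head x f) (e v) = cV v x *: fix_head f (e v) +
      (fun l => \sum_(a | tgt a == v) cA a x *: fix_head f (r a) l).
    apply/funext => l; rewrite /fix_head /= rs_mul_vr (multilinear_head _ _ _ _ fl).
    have hd0 : f (0 :: l) = 0 by exact: (multilinear0 [::]).
    have hdD y z : f (y + z :: l) = f (y :: l) + f (z :: l) by exact: (multilinearD [::]).
    rewrite (big_morph (fun y => f (y :: l)) hdD hd0); congr (_ + _).
    by apply: eq_bigr => a _; exact: (multilinearZ [::]).
  rewrite (linear_walk_sum v t (cV v x) (fix_head f (e v))) (linop_sum (linear_walk_sum _ _)).
  by congr (_ + _); apply: eq_bigr => a /eqP ->.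
module_coef.
Qed.

(** The homotopy evaluates cochains on lists with at least one entry. *)
Lemma eq_homotopy f g s : fix_head f =1 fix_head g -> homotopy f s = homotopy g s.
Proof.
move=> fg; have ps t : path_sum f t = path_sum g t.
  by apply: eq_bigr => v _; rewrite fg.
by case: s => [|x t] /=; rewrite ps ?fg.
Qed.

Lemma sum_trivial_paths : \sum_v e v = 1 :> A.
Proof.
rewrite -[RHS]/(qproj _ 1) -[1 in RHS]/(pa_one k Q) /pa_one.
by rewrite (big_morph _ (@qprojD _ _) (qproj0 k Q)).
Qed.

(** The sum over i telescopes: the terms i and i + 1 of the homotopy differ, by
    [right_diff_path_sum], in whether the argument x_(i+1) is projected onto
    paths.  Starting from no projection at all, this leaves f itself. *)
Lemma right_diff_homotopy f s : multilinear f ->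
  right_diff (homotopy f) s + homotopy (right_diff f) s = - f s.
Proof.
elim: s f => [|x t IH] f fl.
  rewrite right_diff_nil add0r /= subr0 /path_sum.
  rewrite -[f _]mulr1 -sum_trivial_paths mulr_sumr -sumrN; apply: eq_bigr => v _.
  by rewrite walk_sum_nil /fix_head right_diff1 mulNr -mulrA rs_mul_vv eqxx scale1r.
have := IH _ (multilinear_fix_head x fl); rewrite -[fix_head f x t]/(f (x :: t)) => IHx.
have key := right_diff_path_sum x t fl.
have -> : homotopy (right_diff f) (x :: t) = path_sum (right_diff f) (x :: t)
    + homotopy (merge_head x f) t + homotopy (right_diff (fix_head f x)) t.
  rewrite /= -addrA; congr (_ + _); rewrite -(linopD (linear_homotopy t)).
  rewrite -(linopN (linear_homotopy t)); apply: eq_homotopy => y; apply/funext => l.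
  rewrite -[LHS]/(- right_diff f (x :: y :: l)).
  rewrite -[RHS]/(f (x * y :: l) + right_diff (fix_head f x) (y :: l)) right_diff_cons.
  by rewrite opprB addrC opprK.
case: t IHx {IH} key => [|y t] IHx key.
  rewrite right_diff_nil add0r in IHx; rewrite IHx right_diff1 /= !subr0.
  by rewrite right_diff1 in key; rewrite !addrA key add0r.
have -> : right_diff (homotopy f) (x :: y :: t) = right_diff (path_sum f) (x :: y :: t)
    + homotopy (fix_head f (x * y)) t + right_diff (homotopy (fix_head f x)) (y :: t).
  rewrite !right_diff_cons /=.
  rewrite -[fix_head (homotopy f) x]/(fix_head (path_sum f) x - homotopy (fix_head f x)).
  rewrite (linopB (linear_right_diff _)); module_coef.
have -> : homotopy (merge_head x f) (y :: t) =
    path_sum (merge_head x f) (y :: t) - homotopy (fix_head f (x * y)) t by [].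
rewrite -IHx -[RHS]add0r -key; module_coef.
Qed.

Lemma walk_sum_mull v u g s : walk_sum v (fun l => u * g l) s = u * walk_sum v g s.
Proof.
elim: s v g => [|x t IH] v g; first by rewrite !walk_sum_nil mulrA.
rewrite !walk_sum_cons mulr_sumr; apply: eq_bigr => a _.
by rewrite -rs_scaleAr; congr (_ *: _); exact: IH.
Qed.

Lemma path_sum_mull u g s : path_sum (fun l => u * g l) s = u * path_sum g s.
Proof. by rewrite /path_sum mulr_sumr; apply: eq_bigr => v _; apply: walk_sum_mull. Qed.

Lemma homotopy_mull u g s : homotopy (fun l => u * g l) s = u * homotopy g s.
Proof.
elim: s g => [|x t IH] g /=; rewrite path_sum_mull; first by rewrite !subr0.
by rewrite mulrBr; congr (_ - _); exact: IH.
Qed.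

Definition left_diff f s : A := if s is x :: t then x * f t else 0.

(** The operator K. *)
Definition path_proj f s : A := \sum_v e v * walk_sum v f s.

Lemma homotopy_left_diff f s :
  homotopy (left_diff f) s = path_proj f s - left_diff (homotopy f) s.
Proof.
have -> : path_proj f s = path_sum (left_diff f) s.
  by apply: eq_bigr => v _; rewrite -walk_sum_mull.
by case: s => [|x t] //=; congr (_ - _); exact: homotopy_mull.
Qed.

(** Left multiplication by the first argument commutes with the homotopy, except
    in the term i = 0, where the first argument is the idempotent e; this term
    produces e f(a_1, ..., a_n) e'. *)
Lemma homotopy_formula f : multilinear f ->
  (left_diff (homotopy f) + right_diff (homotopy f)) + homotopy (left_diff f + right_diff f)
    = path_proj f - f.
Proof.
move=> fl; apply/funext => s.
rewrite -[LHS]/(left_diff (homotopy f) s + right_diff (homotopy f) s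
   + homotopy (left_diff f + right_diff f) s) -[RHS]/(path_proj f s - f s).
rewrite (linopD (linear_homotopy s)) homotopy_left_diff.
rewrite -[RHS](addrC (- f s)) -(right_diff_homotopy s fl); module_coef.
Qed.

Local Notation d := (hdiff (fun x y : A => x * y)).

Lemma right_diffE n f s : size s = n.+1 ->
  right_diff f s = \sum_(i < n) (-1) ^+ i.+1 *: f (take i s ++ s`_i * s`_i.+1 :: drop i.+2 s)
    + (-1) ^+ n.+1 *: (f (take n s) * s`_n).
Proof.
elim: n f s => [|n IH] f s.
  by case: s => [|x []] // _; rewrite right_diff1 big_ord0 add0r expr1 scaleN1r.
case: s => [|x [|y t]] // [sz].
rewrite right_diff_cons IH; last by rewrite /= sz.
rewrite big_ord_recl /= drop0 expr1 scaleN1r opprD -addrA.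
congr (_ + (_ + _)); last by rewrite [in RHS]exprS mulN1r scaleNr.
by rewrite -sumrN; apply: eq_bigr => i _; rewrite [in RHS]exprS mulN1r scaleNr.
Qed.

Lemma hdiff_right_diff n f : hcochain n f -> d n f = left_diff f + right_diff f.
Proof.
move=> /hcochainP[f0 fl]; apply/funext => s; rewrite /hdiff.
rewrite -[RHS]/(left_diff f s + right_diff f s); case: eqP => sz.
  by rewrite (right_diffE f sz) addrA; case: s sz.
case: s sz => [|x t] /= sz; first by rewrite right_diff_nil addr0.
have nt : size t <> n by move=> st; apply: sz; rewrite st.
rewrite (@right_diffE (size t)) // f0 // mulr0 add0r big1 ?add0r => [|i _].
  rewrite f0 ?mul0r ?scaler0 // size_takel //; exact: leqnSn.
rewrite f0 ?scaler0 // size_cat /= size_take_min /= size_drop /=.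
have lt_i := ltn_ord i; rewrite (minn_idPl (leqW (ltnW lt_i))) addnS -addSn subnKC //.
Qed.

Lemma multilinear_walk_sum v g : multilinear (walk_sum v g).
Proof.
move=> s t c x y; elim: s v g => [|z s IH] v g.
  rewrite !walk_sum_cons scaler_sumr -big_split; apply: eq_bigr => a _ /=.
  by rewrite rs_coef_lin //; module_coef.
rewrite !cat_cons !walk_sum_cons scaler_sumr -big_split; apply: eq_bigr => a _ /=.
by rewrite IH scalerDr !scalerA [_ * c]mulrC.
Qed.

Lemma multilinear_path_sum f : multilinear (path_sum f).
Proof.
move=> s t c x y; rewrite scaler_sumr -big_split; apply: eq_bigr => v _ /=.
exact: multilinear_walk_sum.
Qed.

Lemma multilinear_homotopy f : multilinear f -> multilinear (homotopy f).
Proof.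
move=> fl s t c x y; elim: s f fl => [|z s IH] f fl /=; last first.
  rewrite IH; last exact: multilinear_fix_head.
  by rewrite (multilinear_path_sum f (z :: s)) scalerBr opprD addrACA.
rewrite (multilinear_path_sum f [::]) !cat0s.
have -> : fix_head f (c *: x + y) = c *: fix_head f x + fix_head f y.
  by apply/funext => l; apply: multilinear_head.
by rewrite (linear_homotopy t) scalerBr opprD addrACA.
Qed.

Lemma walk_sum_vanish v g s :
  (forall l, size l = size s -> g l = 0) -> walk_sum v g s = 0.
Proof.
elim: s v g => [|x t IH] v g g0; first by rewrite walk_sum_nil g0 // mul0r.
rewrite walk_sum_cons big1 // => a _; rewrite IH ?scaler0 // => l sl.
by apply: g0 => /=; rewrite sl.
Qed.

Lemma homotopy_vanish f s :
  (forall l, size l = (size s).+1 -> f l = 0) -> homotopy f s = 0.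
Proof.
elim: s f => [|x t IH] f f0 /=; rewrite [path_sum _ _]big1 ?sub0r ?oppr0 //.
- by move=> v _; apply: walk_sum_vanish => l sl; apply: f0; rewrite /= sl.
- by rewrite IH ?oppr0 // => l sl; apply: f0; rewrite /= sl.
by move=> v _; apply: walk_sum_vanish => l sl; apply: f0; rewrite /= sl.
Qed.

Lemma hcochain_homotopy n f : hcochain n f -> hcochain n.-1 (homotopy f).
Proof.
move=> /hcochainP[f0 fl]; apply/hcochainP; split; last exact: multilinear_homotopy.
move=> s sz; apply: homotopy_vanish => l sl; apply: f0; rewrite sl.
by move=> nE; apply: sz; rewrite -nE.
Qed.

Lemma hcochain_path_proj n f : hcochain n f -> hcochain n (path_proj f).
Proof.
move=> /hcochainP[f0 fl]; apply/hcochainP; split=> [s sz|s t c x y].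
  rewrite /path_proj big1 // => v _; rewrite walk_sum_vanish ?mulr0 // => l sl.
  by apply: f0; rewrite sl.
rewrite scaler_sumr -big_split; apply: eq_bigr => v _ /=.
by rewrite multilinear_walk_sum rs_mul_linr.
Qed.

Lemma path_proj_homotopy n f : hcochain n.+1 f ->
  path_proj f = f + d n (homotopy f) + homotopy (d n.+1 f).
Proof.
move=> fn; have fl := ((hcochainP _ _).1 fn).2.
rewrite !hdiff_right_diff //; last exact: (hcochain_homotopy fn).
by rewrite -addrA homotopy_formula // addrC subrK.
Qed.

(** In degree 0 the homotopy of f would have degree -1; it is 0. *)
Lemma path_proj_homotopy0 f : hcochain 0 f ->
  path_proj f = f + homotopy (d 0 f).
Proof.
move=> fn; have [f0 fl] := (hcochainP _ _).1 fn.
have h0 : homotopy f = 0.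
  by apply/funext => s; apply: homotopy_vanish => l sl; apply: f0; rewrite sl.
rewrite hdiff_right_diff // -[homotopy _]add0r.
have {1}<- : left_diff (homotopy f) + right_diff (homotopy f) = 0.
  rewrite h0; apply/funext => s.
  rewrite -[LHS]/(left_diff 0 s + right_diff 0 s) (linop0 (linear_right_diff s)) addr0.
  by case: s => [|x t] //=; rewrite mulr0.
by rewrite homotopy_formula // addrC subrK.
Qed.

Lemma rs_hdiffD n f g : hcochain n f -> hcochain n g -> d n (f + g) = d n f + d n g.
Proof.
move=> fn gn; have := hdiff_lin (@rs_mul_linl k Q) (@rs_mul_linr k Q) 1 fn gn.
by rewrite !scale1r.
Qed.

Lemma rs_hdiff_hdiff n f : hcochain n f -> d n.+1 (d n f) = 0.
Proof. exact: (hdiff_hdiff (@mulrA A) (@rs_mul_linl k Q) (@rs_mul_linr k Q)). Qed.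

Lemma rs_hcochain_hdiff n f : hcochain n f -> hcochain n.+1 (d n f).
Proof. exact: (hcochain_hdiff (@rs_mul_linl k Q) (@rs_mul_linr k Q)). Qed.

Lemma hcochainD n f g : hcochain n f -> hcochain n g -> hcochain n (f + g).
Proof. by move=> fn gn; rewrite -[f]scale1r; apply: hcochain_lin. Qed.

Lemma homotopy0 : homotopy 0 = 0.
Proof. by apply/funext => s; apply: linop0 (linear_homotopy s). Qed.

Lemma path_proj0 : path_proj 0 = 0.
Proof.
apply/funext => s; rewrite /path_proj big1 // => v _.
by rewrite (linop0 (linear_walk_sum v s)) mulr0.
Qed.

Lemma hdiff_path_proj n f : hcochain n f -> d n (path_proj f) = path_proj (d n f).
Proof.
move=> fn; have dfn := rs_hcochain_hdiff fn; have hdfn := hcochain_homotopy dfn.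
have -> : path_proj (d n f) = d n f + d n (homotopy (d n f)).
  by rewrite (path_proj_homotopy dfn) rs_hdiff_hdiff // homotopy0 addr0.
case: n fn dfn hdfn => [|n] fn dfn hdfn; first by rewrite path_proj_homotopy0 // rs_hdiffD.
have hfn := hcochain_homotopy fn; have dhfn := rs_hcochain_hdiff hfn.
rewrite (path_proj_homotopy fn) !rs_hdiffD //; last exact: hcochainD.
by rewrite rs_hdiff_hdiff // addr0.
Qed.

End Homotopy.

(** * The comparison map *)

Section Theta.
Variables (k : fieldType) (Q : quiver).
Local Notation A := (radsq0 k Q).
Implicit Types (f g : seq A -> A) (s t : seq A) (a : arr Q) (v : vert Q).
Implicit Types (p q x y : qpath Q) (b c : ppair Q) (w : seq (arr Q)).
Local Notation e v := (rs_path k (trivial_path v)).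
Local Notation r a := (rs_path k (arrow_path a)).
Local Notation cV v := (rs_coef (trivial_path v)).
Local Notation cA a := (rs_coef (arrow_path a)).
Local Notation d := (hdiff (fun u v : A => u * v)).

Definition path_coef w s : k := \prod_(au <- zip w s) cA au.1 au.2.

Lemma path_coef_nil s : path_coef [::] s = 1.
Proof. by rewrite /path_coef /zip; case: s => [|u s]; rewrite big_nil. Qed.

Lemma path_coef_cons a w u s : path_coef (a :: w) (u :: s) = cA a u * path_coef w s.
Proof. by rewrite /path_coef big_cons. Qed.

Lemma path_coef_cat w1 w2 s1 s2 : size w1 = size s1 ->
  path_coef (w1 ++ w2) (s1 ++ s2) = path_coef w1 s1 * path_coef w2 s2.
Proof. by move=> sz; rewrite /path_coef zip_cat // big_cat. Qed.

Lemma path_coef_lin w s t (c : k) (u z : A) : (size s + size t).+1 = size w ->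
  path_coef w (s ++ (c *: u + z) :: t) =
    c * path_coef w (s ++ u :: t) + path_coef w (s ++ z :: t).
Proof.
elim: w s => [|a w IH] [|y s] //= [sz]; rewrite !path_coef_cons.
  by rewrite rs_coef_lin //; ring.
by rewrite IH //; ring.
Qed.

Lemma path_coef_arrows w w' : size w = size w' ->
  path_coef w [seq r a | a <- w'] = (w == w')%:R.
Proof.
elim: w w' => [|a w IH] [|a' w'] //= sz; first by rewrite path_coef_nil.
rewrite path_coef_cons IH; last by case: sz.
by rewrite rs_coefE eqseq_cons eq_sym; do 2!case: eqP; rewrite ?mulr0 ?mul0r ?mulr1.
Qed.

(** The value of [theta] on the basis element (w, u) ([theta_basis]), but for an
    arbitrary vector u and a word w of arrows which need not be composable. *)
Definition cylinder w (u : A) : seq A -> A :=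
  fun s => if size s == size w then path_coef w s *: u else 0.

Lemma theta_lin (c : k) (x y : CQ k Q) : theta (c *: x + y) = c *: theta x + theta y.
Proof.
by rewrite /theta (fglift_is_linear (@reduced_cochain k Q) c x y).
Qed.

Lemma rs_coef_rad_proj a u : cA a (rad_proj u) = cA a (u : A).
Proof.
rewrite [in RHS](rs_decomp u) [in RHS]addrC.
rewrite -[\sum_a _]scale1r rs_coef_lin // mul1r.
have -> : cA a (\sum_v cV v u *: e v) = 0.
  elim/big_ind: _ => [|y z ey ez|v _]; first by rewrite rs_coef0.
    by rewrite -[y]scale1r rs_coef_lin // ey ez mulr0 addr0.
  by rewrite rs_coefZ // rs_coefE mulr0.
by rewrite addr0.
Qed.

Lemma theta_basis b : theta << b >> = cylinder (arrows (val b).1) (rs_path k (val b).2).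
Proof.
apply/funext => s; rewrite /theta /inflate fglift_basis /cylinder /reduced_cochain.
case: (val b) => p x; rewrite size_map /plen; case: eqP => // sz; congr (_ *: _).
elim: (arrows p) s sz => [|a w IH] [|u s] //= sz.
rewrite path_coef_cons big_cons rs_coef_rad_proj; congr (_ * _).
by apply: IH; case: sz.
Qed.

Lemma cylinder_arrows w u w' :
  cylinder w u [seq r a | a <- w'] = (w == w')%:R *: u.
Proof.
rewrite /cylinder size_map; case: eqP => [sz|sz]; first by rewrite path_coef_arrows.
by case: eqP sz => [->|_] //; rewrite scale0r.
Qed.

(** The arrows determine a path unless it is trivial, but its source is also the
    source of the parallel second component. *)
Lemma ppair_arrows_inj b c :
  arrows (val b).1 = arrows (val c).1 -> (val b).2 = (val c).2 -> b = c.
Proof.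
case: b c => [[p x] /= bP] [[q y] /= cP] pq xy; apply: val_inj => /=.
case/andP: bP => /andP[/eqP px _] _; case/andP: cP => /andP[/eqP qy _] _.
rewrite -xy; congr (_, _); apply: val_inj => /=; move: pq px qy; rewrite /arrows /psrc xy.
by case: (path_data p) (path_data q) => [v w] [v' w'] /= -> -> ->.
Qed.

Lemma plen_ppair b : (plen (val b).2 <= 1)%N.
Proof. by case/andP: (valP b). Qed.

(** Evaluation at the arrows of a path recovers the coordinates of an element of
    C(Q) from its image; injectivity of [theta] and [CQ_degP] follow. *)
Lemma rs_coef_theta b (z : CQ k Q) :
  rs_coef (val b).2 (theta z [seq r a | a <- arrows (val b).1]) = coeff b z.
Proof.
have lb := plen_ppair b.
apply: (freeg_lin_ind (P := fun z : CQ k Q =>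
  rs_coef (val b).2 (theta z [seq r a | a <- arrows (val b).1]) = coeff b z) (x := z)).
- have := theta_lin (-1) 0 0; rewrite scaler0 addr0 scaleN1r addNr => ->.
  by rewrite rs_coef0 // coeff0.
- move=> l x y ex ey; rewrite theta_lin -[(_ + _) _]/(l *: theta x _ + theta y _).
  by rewrite rs_coef_lin // ex ey coeffD coeffZ.
move=> c _; rewrite theta_basis cylinder_arrows rs_coefZ // rs_coef_path // coeffU mul1r.
have -> : (c == b) = (arrows (val c).1 == arrows (val b).1) && ((val c).2 == (val b).2).
  by apply/eqP/andP => [->|[/eqP e1 /eqP e2]]; [rewrite !eqxx | apply: ppair_arrows_inj].
by case: (_ == _); rewrite ?mul1r ?mul0r.
Qed.

Lemma theta_inj (x y : CQ k Q) : theta x = theta y -> x = y.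
Proof.
by move=> xy; apply/eqP/freeg_eqP => b; rewrite -!rs_coef_theta xy.
Qed.

Lemma theta0 : theta (0 : CQ k Q) = 0.
Proof. by have := theta_lin (-1) 0 0; rewrite scaler0 addr0 scaleN1r addNr. Qed.

Lemma hcochain_cylinder w u : hcochain (size w) (cylinder w u).
Proof.
split=> [s /eqP sz|s t c y z sz]; first by rewrite /cylinder (negPf sz).
have szE (y' : A) : size (s ++ y' :: t) = size w by rewrite size_cat /= addnS.
by rewrite /cylinder !szE eqxx path_coef_lin // scalerDl scalerA.
Qed.

(** Degrees in C(Q) can be read off after applying [theta], so that the degrees
    of differentials and brackets need no separate computation. *)
Lemma CQ_degP n (z : CQ k Q) : CQ_deg n z <-> hcochain n (theta z).
Proof.
split=> [zn|zn b]; last first.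
  rewrite mem_dom -rs_coef_theta => nz; apply/eqP; apply: contraNT nz => /eqP sz.
  case: zn => z0 _; rewrite z0 ?rs_coef0 //; first exact: plen_ppair.
  by rewrite size_map.
apply: (freeg_lin_ind (P := fun z : CQ k Q => hcochain n (theta z)) (x := z)).
- by rewrite theta0; exact: hcochain0.
- by move=> c x y xn yn; rewrite theta_lin; apply: hcochain_lin.
by move=> b /zn <-; rewrite theta_basis; exact: hcochain_cylinder.
Qed.

Lemma CQ_deg_ind n (P : CQ k Q -> Prop) (z : CQ k Q) :
  P 0 -> (forall (l : k) (y y' : CQ k Q), P y -> P y' -> P (l *: y + y')) ->
  (forall b, plen (val b).1 = n -> P << b >>) -> CQ_deg n z -> P z.
Proof. by move=> P0 Pl Pb zn; apply: freeg_lin_ind => // b /zn; exact: Pb. Qed.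

Lemma fix_head_cylinder a w u a' :
  fix_head (cylinder (a :: w) u) (r a') = (a' == a)%:R *: cylinder w u.
Proof.
apply/funext => l; rewrite -[RHS]/(_ *: cylinder w u l) /fix_head /cylinder /= eqSS.
case: (_ == size w); last by rewrite scaler0.
by rewrite path_coef_cons rs_coefE scalerA eq_sym.
Qed.

Lemma walk_sum_cylinder v w u s :
  walk_sum v (cylinder w u) s =
    cylinder w ((walk v w)%:R *: (u * e (last v [seq tgt a | a <- w]))) s.
Proof.
elim: s v w => [|y t IH] v [|a w].
- by rewrite walk_sum_nil /cylinder /= !path_coef_nil !scale1r.
- by rewrite walk_sum_nil /cylinder /= mul0r.
- by rewrite walk_sum_vanish // => l sl; rewrite /cylinder sl.
rewrite walk_sum_cons big_mkcond (bigD1 a) //= big1 ?addr0 => [|b /negPf ba]; last first.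
  rewrite fix_head_cylinder ba scale0r (linop0 (linear_walk_sum _ _)) scaler0.
  by case: ifP.
rewrite fix_head_cylinder eqxx scale1r IH /cylinder /= eqSS path_coef_cons.
case: (_ == size w); last by rewrite scaler0; case: ifP.
by case: (src a == v); rewrite /= ?scale0r ?scaler0 // !scalerA.
Qed.

Lemma walk_arrows p : walk (psrc p) (arrows p).
Proof. exact: path_dataP. Qed.

Lemma path_proj_theta (z : CQ k Q) : path_proj (theta z) = theta z.
Proof.
apply/funext => s; rewrite /path_proj.
apply: (freeg_lin_ind (P := fun z : CQ k Q =>
  \sum_v e v * walk_sum v (theta z) s = theta z s) (x := z)).
- rewrite theta0 big1 // => v _.
  by rewrite (linop0 (linear_walk_sum _ _)) mulr0.
- move=> l x y ex ey; rewrite theta_lin -[RHS]/(l *: theta x s + theta y s) -ex -ey.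
  rewrite scaler_sumr -big_split; apply: eq_bigr => v _ /=.
  by rewrite linear_walk_sum rs_mul_linr.
move=> b _; rewrite theta_basis; case: b => [[p x]] /= /andP[/andP[/eqP px /eqP qy] _].
rewrite (bigD1 (psrc p)) //= big1 ?addr0 => [|v vp].
  rewrite walk_sum_cylinder walk_arrows scale1r /cylinder; case: eqP => _; last by rewrite mulr0.
  rewrite -rs_scaleAr; congr (_ *: _); rewrite -/(pend p) qy px rs_pathM pcat_trivr eqxx.
  by rewrite rs_pathM pcat_trivl eqxx.
rewrite walk_sum_cylinder /cylinder; case: eqP => _; last by rewrite mulr0.
by rewrite -!rs_scaleAr mulrA rs_pathM pcat_trivl -px (negPf vp) mul0r !scaler0.
Qed.

Lemma eq_walk_sum v f g s :
  (forall w, walk v w -> f [seq r a | a <- w] = g [seq r a | a <- w]) ->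
  walk_sum v f s = walk_sum v g s.
Proof.
elim: s v f g => [|x t IH] v f g fg; first by rewrite !walk_sum_nil (fg [::]).
rewrite !walk_sum_cons; apply: eq_bigr => a sa; congr (_ *: _); apply: IH => w ww.
by apply: (fg (a :: w)); rewrite /= sa.
Qed.

Fixpoint walks (n : nat) v : seq (seq (arr Q)) :=
  if n is m.+1 then
    flatten [seq [seq a :: w | w <- walks m (tgt a)] | a <- enum [pred a | src a == v]]
  else [:: [::]].

Lemma walksP n v w : w \in walks n v -> walk v w /\ size w = n.
Proof.
elim: n v w => [|n IH] v w; first by rewrite inE => /eqP ->.
case/flatten_mapP => a; rewrite mem_enum inE => sa /mapP[w' /IH[ww sw] ->] /=.
by rewrite sa ww sw.
Qed.

Lemma walk_sumE v g s : walk_sum v g s =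
  \sum_(w <- walks (size s) v)
    path_coef w s *: (g [seq r a | a <- w] * e (last v [seq tgt a | a <- w])).
Proof.
elim: s v g => [|x t IH] v g; first by rewrite big_seq1 path_coef_nil scale1r.
rewrite walk_sum_cons /= big_flatten /= big_map big_enum /=; apply: eq_bigr => a _.
rewrite IH scaler_sumr big_map; apply: eq_bigr => w _.
by rewrite path_coef_cons scalerA.
Qed.

Lemma path_proj_cylinders n f : hcochain n f ->
  path_proj f = \sum_v \sum_(w <- walks n v)
    cylinder w (e v * (f [seq r a | a <- w] * e (last v [seq tgt a | a <- w]))).
Proof.
move=> fn; have [K0 _] := hcochain_path_proj fn.
apply/funext => s; rewrite fct_sumE; have [sz|/eqP sz] := eqVneq (size s) n; last first.
  rewrite K0 // big1 // => v _; rewrite fct_sumE big_seq big1 // => w /walksP[_ sw].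
  by rewrite /cylinder sw (introF eqP sz).
apply: eq_bigr => v _; rewrite fct_sumE walk_sumE sz mulr_sumr big_seq [RHS]big_seq.
by apply: eq_bigr => w /walksP[_ sw]; rewrite /cylinder sz sw eqxx -rs_scaleAr.
Qed.

Lemma rs_corner v v' (u : A) : e v * (u * e v') =
  (v == v')%:R *: (cV v' u *: e v')
  + \sum_(a | (tgt a == v') && (src a == v)) cA a u *: r a.
Proof.
rewrite rs_mul_vr rs_mul_linr rs_mul_vv scalerA mulrC -scalerA; congr (_ + _).
rewrite mulr_sumr big_mkcondr; apply: eq_bigr => a _; rewrite -rs_scaleAr rs_mul_va.
by case: eqP => _; rewrite ?scale1r // scale0r scaler0.
Qed.

Lemma cylinder_lin w (l : k) (u u' : A) :
  cylinder w (l *: u + u') = l *: cylinder w u + cylinder w u'.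
Proof.
apply/funext => s; rewrite -[RHS]/(l *: cylinder w u s + cylinder w u' s) /cylinder.
case: eqP => _; first by rewrite scalerDr !scalerA mulrC.
by rewrite scaler0 addr0.
Qed.

(** The vectors e_v u e_w are the combinations of the vertices and arrows from v
    to w ([rs_corner]), that is, of the admissible second components of a basis
    element whose first component goes from v to w. *)
Lemma path_proj_image n f : hcochain n f ->
  exists2 z : CQ k Q, CQ_deg n z & theta z = path_proj f.
Proof.
move=> fn; rewrite (path_proj_cylinders fn).
pose Im F := exists2 z : CQ k Q, CQ_deg n z & theta z = F.
have Im0 : Im 0 by exists 0; [apply/CQ_degP; rewrite theta0; exact: hcochain0 | exact: theta0].
have Iml l F G : Im F -> Im G -> Im (l *: F + G).
  move=> [y yn <-] [z zn <-]; exists (l *: y + z); last exact: theta_lin.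
  apply/CQ_degP; rewrite theta_lin; apply: hcochain_lin; exact/CQ_degP.
have ImD F G : Im F -> Im G -> Im (F + G).
  by move=> ? ?; rewrite -[F]scale1r; apply: Iml.
have Imb (b : ppair Q) : size (arrows (val b).1) = n ->
    Im (cylinder (arrows (val b).1) (rs_path k (val b).2)).
  move=> bn; exists << b >>; last exact: theta_basis.
  by apply/CQ_degP; rewrite theta_basis -bn; exact: hcochain_cylinder.
apply: (big_ind Im) => // v _; rewrite big_seq; apply: (big_ind Im) => // w /walksP[ww sw].
pose p := @QPath Q (v, w) ww.
have cyl0 : cylinder w 0 = 0 :> (seq A -> A).
  by apply/funext => s; rewrite /cylinder scaler0 if_same.
have cylZ l u : Im (cylinder w u) -> Im (cylinder w (l *: u)).
  by move=> Iu; rewrite -[l *: u]addr0 cylinder_lin cyl0; apply: Iml.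
rewrite rs_corner -[X in X + _]scale1r cylinder_lin; apply: Iml.
  case: eqP => [vE|_]; last by rewrite scale0r cyl0.
  have bP : parallel p (trivial_path v) && (plen (trivial_path v) <= 1)%N.
    by rewrite /parallel /= eqxx /= -/(pend p) /pend /= eq_sym; apply/andP; split => //; apply/eqP.
  by do 2!apply: (cylZ _ _); rewrite -vE; exact: (Imb (exist _ (p, trivial_path v) bP)).

have cylD u u' : cylinder w (u + u') = cylinder w u + cylinder w u'.
  by have := cylinder_lin w 1 u u'; rewrite !scale1r.
rewrite (big_morph _ cylD cyl0); apply: (big_ind Im) => // a /andP[ta sa].
have bP : parallel p (arrow_path a) && (plen (arrow_path a) <= 1)%N.
  by rewrite /parallel /= eq_sym sa eq_sym ta.
by apply: cylZ; exact: (Imb (exist _ (p, arrow_path a) bP)).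
Qed.

Lemma thetaD (y z : CQ k Q) : theta (y + z) = theta y + theta z.
Proof. by have := theta_lin 1 y z; rewrite !scale1r. Qed.

Lemma thetaZ (l : k) (y : CQ k Q) : theta (l *: y) = l *: theta y.
Proof. by have := theta_lin l y 0; rewrite theta0 !addr0. Qed.

Lemma theta_pair_elt p x : parallel p x -> (plen x <= 1)%N ->
  theta (pair_elt k (Some p) x) = cylinder (arrows p) (rs_path k x).
Proof.
move=> px lx; rewrite /pair_elt /=; case: insubP => [b _ bE|]; last by rewrite /= px lx.
by rewrite theta_basis bE.
Qed.

Lemma theta_D_trivial b v : (val b).2 = trivial_path v ->
  theta (D_basis k b) =
    \sum_(a | tgt a == v) cylinder (a :: arrows (val b).1) (r a)
    + (-1) ^+ (plen (val b).1).+1 *: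
      \sum_(a | src a == v) cylinder (rcons (arrows (val b).1) a) (r a).
Proof.
case: b => [[p x] bP] /= xv; subst x.
case/andP: (bP) => /andP[/eqP pv /eqP qv] _; rewrite -[psrc (trivial_path v)]/v in pv.
rewrite -[pend (trivial_path v)]/v in qv.
rewrite /D_basis /= thetaD thetaZ !(big_morph _ thetaD theta0).
congr (_ + _ *: _); apply: eq_bigr => a /eqP; rewrite -[psrc _]/v => av.
  have [|q -> qE] := @pcatP Q (arrow_path a) p; first by rewrite /composable pv -av.
  rewrite theta_pair_elt ?/arrows ?qE //; rewrite /parallel /psrc qE eqxx /=.
  by rewrite (pend_cat _ qE) ?qv -?av ?/composable ?pv -?av //; apply/eqP.
have [|q -> qE] := @pcatP Q p (arrow_path a); first by rewrite /composable qv -av.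
rewrite theta_pair_elt ?/arrows ?qE ?cats1 //; rewrite /parallel /psrc qE /=.
by rewrite -/(psrc p) pv -av eqxx /= (pend_cat _ qE) // /composable qv -av.
Qed.

Lemma D_basis_arrow b a : (val b).2 = arrow_path a -> D_basis k b = 0.
Proof. by rewrite /D_basis; case: (val b) => p x /= ->. Qed.

Lemma sum_arrow_delta (P : pred (arr Q)) a0 (h : bool) :
  \sum_(a | P a) ((a == a0) && h)%:R *: r a = (h && P a0)%:R *: r a0.
Proof.
rewrite big_mkcond (bigD1 a0) //= eqxx big1 ?addr0 => [|a /negPf ->].
  by case: (P a0); rewrite andbC //= scale0r.
by rewrite scale0r; case: ifP.
Qed.

Lemma sum_cylinder_arrows (P : pred (arr Q)) (h : arr Q -> seq (arr Q)) w :
  (\sum_(a | P a) cylinder (h a) (r a)) [seq r a | a <- w] =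
  \sum_(a | P a) (h a == w)%:R *: r a.
Proof. by rewrite fct_sumE; apply: eq_bigr => a _; rewrite cylinder_arrows. Qed.

(** On arrows the inner terms of the differential vanish, and the two outer ones
    give the two sums of [D_basis].  If the second component of b is an arrow,
    its products with arrows vanish, as does [D_basis]. *)
Lemma hdiff_theta_basis b w :
  d (plen (val b).1) (theta << b >>) [seq r a | a <- w]
    = theta (D_basis k b) [seq r a | a <- w].
Proof.
rewrite theta_basis; set n := plen _.
have hc := hcochain_cylinder (arrows (val b).1) (rs_path k (val b).2).
have [sw|sw] := eqVneq (size w) n.+1; last first.
  rewrite /hdiff size_map (negPf sw); case: (short_path (plen_ppair b)) => [[v' bv]|[a ba]].
    rewrite (theta_D_trivial bv) -[RHS]/(_ _ + _ *: _ _) !sum_cylinder_arrows.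
    rewrite !big1 ?scaler0 ?addr0 // => a _; case: eqP => [E|_]; rewrite ?scale0r //.
      by move: sw; rewrite -E /n /plen size_rcons eqxx.
    by move: sw; rewrite -E /n /plen eqxx.
  by rewrite (D_basis_arrow ba) theta0.
case: w sw => [//|a0 w] [sw].
have -> : d n (cylinder (arrows (val b).1) (rs_path k (val b).2)) [seq r a | a <- a0 :: w]
  = (arrows (val b).1 == w)%:R *: (r a0 * rs_path k (val b).2)
    + (-1) ^+ n.+1 *: ((arrows (val b).1 == take n (a0 :: w))%:R *:
        (rs_path k (val b).2 * r (nth a0 (a0 :: w) n))).
  rewrite /hdiff size_map /= sw eqxx big1 ?addr0 => [|i _].
    rewrite cylinder_arrows -rs_scaleAr; congr (_ + _ *: _).
    rewrite -[r a0 :: _]/[seq r a | a <- a0 :: w] -map_take cylinder_arrows.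
    rewrite -[_`_n]/([seq r a | a <- a0 :: w]`_n) (nth_map a0) /= ?sw //.
    by rewrite -rs_scaleAl.
  rewrite -[r a0 :: _]/[seq r a | a <- a0 :: w] !(nth_map a0) /= ?sw ?ltnS //; try exact: ltnW.
  by rewrite rs_mul_aa multilinear0 ?scaler0 //; case/hcochainP: hc.
case: (short_path (plen_ppair b)) => [[v' bv]|[a ba]]; last first.
  by rewrite (D_basis_arrow ba) theta0 ba !rs_mul_aa !scaler0 addr0.
rewrite (theta_D_trivial bv) bv -[RHS]/(_ _ + _ *: _ _) !sum_cylinder_arrows.
congr (_ + _ *: _).
  under [RHS]eq_bigr do rewrite eqseq_cons.
  by rewrite sum_arrow_delta rs_mul_av scalerA -natrM mulnb.
(* The second outer term splits off the last arrow instead of the first. *)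
have wE : a0 :: w = rcons (take n (a0 :: w)) (nth a0 (a0 :: w) n).
  by rewrite -take_nth /= ?sw // take_oversize //= sw.
under [RHS]eq_bigr do rewrite wE eqseq_rcons andbC.
by rewrite sum_arrow_delta rs_mul_va scalerA -natrM mulnb.
Qed.

(** Both sides are fixed by [path_proj], which commutes with the differential.
    It is therefore enough to evaluate them at words of arrows. *)
Lemma theta_D n (z : CQ k Q) : CQ_deg n z -> theta (D z) = d n (theta z).
Proof.
move=> zn; pose P z := hcochain n (theta z) /\ theta (D z) = d n (theta z) :> (seq A -> A).
suff: P z by case.
have linl := @rs_mul_linl k Q; have linr := @rs_mul_linr k Q.
apply: (CQ_deg_ind (n := n)) zn => [|l y y' [yn ey] [y'n ey']|b bn].
- have hc0 := hcochain0 A n.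
  have D0 : D (0 : CQ k Q) = 0.
    by have := fglift_is_linear (@D_basis k Q) (-1) 0 0; rewrite scaler0 addr0 scaleN1r addNr.
  by split; rewrite ?D0 theta0 // (hdiff0 linl linr).
- split; first by rewrite theta_lin; apply: hcochain_lin.
  rewrite [D _](fglift_is_linear (@D_basis k Q)) !theta_lin ey ey'.
  by rewrite (hdiff_lin linl linr).
have bc : hcochain n (theta (<< b >> : CQ k Q)).
  by rewrite theta_basis -bn; apply: hcochain_cylinder.
split=> //; rewrite [D _]fglift_basis -[theta << b >>]path_proj_theta.
rewrite hdiff_path_proj // -[LHS]path_proj_theta; apply/funext => s.
apply: eq_bigr => v _; congr (_ * _); apply: eq_walk_sum => w _.
by rewrite -bn -hdiff_theta_basis.
Qed.

Lemma arrows_split p (i : 'I_(plen p)) : arrows p =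
  take i (arrows p) ++ tnth (in_tuple (arrows p)) i :: drop i.+1 (arrows p).
Proof.
rewrite -{1}(cat_take_drop i (arrows p)) (drop_nth (tnth (in_tuple (arrows p)) i)).
  by rewrite {2}(tnth_nth (tnth (in_tuple (arrows p)) i)).
exact: ltn_ord.
Qed.

Lemma replace_arrowP p q (i : 'I_(plen p)) :
  parallel q (arrow_path (tnth (in_tuple (arrows p)) i)) ->
  exists2 p', replace_arrow p i q = Some p' &
    parallel p p' /\ arrows p' = take i (arrows p) ++ arrows q ++ drop i.+1 (arrows p).
Proof.
have pE := arrows_split i; move: pE; set a := tnth _ _ => pE.
move=> /andP[/eqP qs /eqP qt]; rewrite -[psrc (arrow_path _)]/(src a) in qs.
rewrite -[pend (arrow_path _)]/(tgt a) in qt.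
have := walk_arrows p; rewrite {1}pE walk_cat => /andP[w1 /= /andP[/eqP sa w2]].
rewrite /replace_arrow; case: insubP => [p' _ p'E|]; last first.
  by rewrite /= walk_cat w1 walk_cat -sa -qs walk_arrows -/(pend q) qt w2.
exists p' => //; rewrite /parallel /pend /arrows /psrc p'E eqxx /=; split=> //.
rewrite -/(psrc p) -/(arrows p) {1}pE !map_cat !last_cat /=.
by rewrite -sa -qs -/(pend q) qt.
Qed.

(** The inserted value is a multiple of y, and theta (p, x) reads off its
    coordinate on the i-th arrow of p; the remaining arguments are read along
    the path in which that arrow is replaced. *)
Lemma theta_circ b c (i : 'I_(plen (val b).1)) s :
  theta (@circ_basis k Q b c i) s =
    if size s == (plen (val b).1 + plen (val c).1).-1 then
      theta << b >> (take i s ++ theta << c >> (take (plen (val c).1) (drop i s))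
                      :: drop (i + plen (val c).1) s)
    else 0.
Proof.
case: b i => [[p x] bP] /= i; case: c => [[q y] cP] /=.
have pE := arrows_split i; have repl := @replace_arrowP p q i.
have lt_i := ltn_ord i; move: pE repl; set a := tnth _ _ => pE repl.
have -> : theta (@circ_basis k Q (exist _ (p, x) bP) (exist _ (q, y) cP) i) s
   = (y == arrow_path a)%:R *:
     cylinder (take i (arrows p) ++ arrows q ++ drop i.+1 (arrows p)) (rs_path k x) s.
  rewrite /circ_basis /= -/a; case: eqP => [yE|_]; last by rewrite theta0 scale0r.
  have [|p' -> [pp' <-]] := repl; first by rewrite -yE; case/andP: cP.
  case/andP: bP => /andP[px qx] lx.
  case/andP: pp' => /eqP pp' /eqP qp'.
  by rewrite scale1r theta_pair_elt // /parallel -pp' -qp' px.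
rewrite !theta_basis /= /cylinder.
have szc : size (take i (arrows p) ++ arrows q ++ drop i.+1 (arrows p))
    = (plen p + plen q).-1.
  rewrite !size_cat size_take_min size_drop -/(plen p) -/(plen q); lia.
rewrite szc; case: (size s =P _) => sz; last by rewrite scaler0.
have sz2 : size (take (plen q) (drop i s)) = size (arrows q).
  by rewrite size_take_min size_drop -/(plen q) sz; lia.
have sz1 : size (take i (arrows p)) = size (take i s).
  by rewrite !size_take_min -/(plen p) sz; lia.
have szt (u : A) : size (take i s ++ u :: drop (i + plen q) s) = size (arrows p).
  by rewrite size_cat /= size_take_min size_drop sz -/(plen p); lia.
rewrite szt eqxx sz2 eqxx [in RHS]pE path_coef_cat // path_coef_cons.
rewrite rs_coefZ // rs_coef_path // scalerA.
rewrite -{1}(cat_take_drop i s) path_coef_cat // -{1}(cat_take_drop (plen q) (drop i s)).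
rewrite path_coef_cat // drop_drop [(plen q + i)%N]addnC; congr (_ *: _); ring.
Qed.

Lemma gcirc_theta b c :
  gcirc (plen (val b).1) (plen (val c).1) (theta << b >>) (theta << c >>) =
  theta (\sum_(i < plen (val b).1) (-1) ^+ (i * (plen (val c).1).-1) *: @circ_basis k Q b c i).
Proof.
apply/funext => s; rewrite (big_morph _ thetaD theta0) fct_sumE /gcirc.
case: ifP => sz; last first.
  by rewrite big1 // => i _; rewrite thetaZ -[LHS]/(_ *: theta _ s) theta_circ sz scaler0.
by apply: eq_bigr => i _; rewrite thetaZ -[RHS]/(_ *: theta _ s) theta_circ sz.
Qed.

Lemma theta_bracket_basis b c :
  theta (bracketQ_basis k b c) =
    gbracket (plen (val b).1) (plen (val c).1) (theta << b >>) (theta << c >>).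
Proof.
by rewrite /bracketQ_basis /gbracket !gcirc_theta -scaleNr thetaD thetaZ scaleNr.
Qed.

Lemma theta_bracket i j (y z : CQ k Q) : CQ_deg i.+1 y -> CQ_deg j.+1 z ->
  theta (bracketQ y z) = gbracket i.+1 j.+1 (theta y) (theta z).
Proof.
move=> yi zj; have zc := (CQ_degP _ _).1 zj; rewrite gbracketE //; last exact/CQ_degP.
pose bl (y : CQ k Q) := bracketQ y z; rewrite -[bracketQ y z]/(bl y).
have bll l (y1 y2 : CQ k Q) : bl (l *: y1 + y2) = l *: bl y1 + bl y2 by exact: fglift_is_linear.
have bl0 : bl 0 = 0 by have := bll (-1) 0 0; rewrite scaler0 addr0 scaleN1r addNr.
apply: (CQ_deg_ind (P := fun y : CQ k Q => theta (bl y) = lie i.+1 j.+1 (theta y) (theta z))) yi => [|l y1 y2 e1 e2|b bi].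
- by rewrite bl0 theta0 lie0l.
- by rewrite bll !theta_lin lie_linl // e1 e2.
have bc : hcochain i.+1 (theta (<< b >> : CQ k Q)).
  by rewrite theta_basis -bi; apply: hcochain_cylinder.
have -> : bl << b >> = fglift (fun c => bracketQ_basis k b c) z by exact: fglift_basis.
apply: (CQ_deg_ind (P := fun z : CQ k Q => theta (fglift (fun c => bracketQ_basis k b c) z)
   = lie i.+1 j.+1 (theta << b >>) (theta z))) zj => [|l z1 z2 e1 e2|c cj].
- by rewrite (linear0 (fglift _)) theta0 lie0r.
- by rewrite [fglift _ _]fglift_is_linear !theta_lin lie_linr // e1 e2.
have cc : hcochain j.+1 (theta (<< c >> : CQ k Q)).
  by rewrite theta_basis -cj; apply: hcochain_cylinder.
by rewrite fglift_basis theta_bracket_basis bi cj gbracketE.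
Qed.

End Theta.

(** * Transport of structure and conclusion *)

(** All axioms are statements of membership in Z or B, and these are detected by
    phi. *)
Lemma graded_lie_pullback (k : fieldType) (V V' : lmodType k)
    (Z B : nat -> V -> Prop) (br : nat -> nat -> V -> V -> V)
    (Z' B' : nat -> V' -> Prop) (br' : nat -> nat -> V' -> V' -> V') (phi : V -> V') :
  linear phi ->
  (forall i x, Z i x <-> Z' i (phi x)) ->
  (forall i x, B i x <-> B' i (phi x)) ->
  (forall i j x y, Z i x -> Z j y -> phi (br i j x y) = br' i j (phi x) (phi y)) ->
  graded_lie Z' B' br' -> graded_lie Z B br.
Proof.
move=> phil ZE BE brE GL.
have phi0 : phi 0 = 0 by have := phil (-1) 0 0; rewrite scaler0 addr0 scaleN1r addNr.
have phiZ c x : phi (c *: x) = c *: phi x by have := phil c x 0; rewrite phi0 !addr0.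
have phiD x y : phi (x + y) = phi x + phi y by have := phil 1 x y; rewrite !scale1r.
have phiN x : phi (- x) = - phi x by rewrite -scaleN1r phiZ scaleN1r.
have phiE := (phiD, phiN, phiZ).
have subm (P : nat -> V -> Prop) (P' : nat -> V' -> Prop) i :
    (forall x, P i x <-> P' i (phi x)) -> submodule (P' i) -> submodule (P i).
  by move=> PE [P0 Pl]; split=> [|c x y /PE Px /PE Py]; apply/PE; rewrite ?phi0 // phil; apply: Pl.
have closed i j x y : Z i x -> Z j y -> Z (i + j)%N (br i j x y).
  by move=> Zx Zy; apply/ZE; rewrite brE //; apply: (gl_closed GL); apply/ZE.
have Zl i c x y : Z i x -> Z i y -> Z i (c *: x + y).
  by move=> /ZE Zx /ZE Zy; apply/ZE; rewrite phil; apply: (gl_submodZ GL i).2.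
have BZ i x : B i x -> Z i x by move=> /BE Bx; apply/ZE; apply: (gl_sub GL).
split=> [i|i|i x|i j x y|i j x y|i j x y|i j c x x' y|i j c x y y'|i j x y|i j l x y z].
- exact: subm (gl_submodZ GL i).
- exact: subm (gl_submodB GL i).
- exact: BZ.
- exact: closed.
- move=> Bx Zy; apply/BE; rewrite brE //; last exact: BZ.
  by apply: (gl_ideall GL); [apply/BE | apply/ZE].
- move=> Zx By; apply/BE; rewrite brE //; last exact: BZ.
  by apply: (gl_idealr GL); [apply/ZE | apply/BE].
- move=> Zx Zx' Zy; apply/BE; rewrite !phiE !brE ?phil //; last exact: Zl.
  by apply: (gl_linl GL); apply/ZE.
- move=> Zx Zy Zy'; apply/BE; rewrite !phiE !brE ?phil //; last exact: Zl.
  by apply: (gl_linr GL); apply/ZE.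
- move=> Zx Zy; apply/BE; rewrite !phiE !brE //.
  by apply: (gl_antisym GL); apply/ZE.
move=> Zx Zy Zz; apply/BE; rewrite !phiE !brE //; try exact: closed.
by apply: (gl_jacobi GL); apply/ZE.
Qed.

Theorem corollary3p3 (k : fieldType) (Q : quiver) :
  let ZQ i := cocycle (@CQ_deg k Q) (fun _ => @D k Q) i.+1 in
  let BQ i := coboundary (@CQ_deg k Q) (fun _ => @D k Q) i.+1 in
  let brQ (i j : nat) := @bracketQ k Q in
  let A := radsq0 k Q in
  let ZA i := cocycle (@hcochain k A) (hdiff (fun u v : A => u * v)) i.+1 in
  let BA i := coboundary (@hcochain k A) (hdiff (fun u v : A => u * v)) i.+1 in
  let brA i j := @gbracket k A i.+1 j.+1 in
  [/\ graded_lie (fun i => @CQ_deg k Q i.+1) (fun _ c => c = 0) brQ,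
      graded_lie ZQ BQ brQ,
      graded_lie ZA BA brA
    & graded_lie_iso ZQ BQ brQ ZA BA brA (@theta k Q)].
Proof.
move=> ZQ BQ brQ A ZA BA brA.
have thetal : linear (@theta k Q) by move=> c x y; exact: theta_lin.
have thetaI x : theta x = 0 <-> x = 0 :> CQ k Q.
  by split=> [|->]; rewrite ?theta0 // -theta0; apply: theta_inj.
have GLA : graded_lie ZA BA brA.
  exact: (graded_lie_cohomology (@mulrA A) (@rs_mul_linl k Q) (@rs_mul_linr k Q)).
have ZE i x : ZQ i x <-> ZA i (theta x).
  split=> [[xi dx]|[xi dx]]; have xi' := (CQ_degP _ x).
    by split; [apply/CQ_degP | rewrite -theta_D // dx theta0].
  by split; [apply/CQ_degP | apply/thetaI; rewrite (theta_D ((CQ_degP _ _).2 xi))].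
have BE i x : BQ i x <-> BA i (theta x).
  split=> [[y yi ->]|[f fi ef]].
    by exists (theta y); [apply/CQ_degP | rewrite (theta_D yi)].
  have [y yi ey] := path_proj_image fi; exists y => //; apply: theta_inj.
  by rewrite (theta_D yi) ey hdiff_path_proj // -ef path_proj_theta.
have brE i j x y : ZQ i x -> ZQ j y -> theta (brQ i j x y) = brA i j (theta x) (theta y).
  by move=> [xi _] [yj _]; exact: theta_bracket.
split=> //.
- apply: (graded_lie_pullback thetal _ _ _ (graded_lie_cochains A)) => [i x|i x|i j x y].
  + exact: CQ_degP.
  + by split=> /thetaI.
  + exact: theta_bracket.
- exact: (graded_lie_pullback thetal ZE BE brE GLA).
split=> // [i x|i f [fi df]|i j x y Zx Zy].
- exact: (ZE i x).1.
- have [z zi ez] := path_proj_image fi.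
  have Kf := path_proj_homotopy fi; rewrite df homotopy0 addr0 in Kf.
  (* [Kf] reads theta z = f + d (H f): the cocycle f is cohomologous to theta z. *)
  exists z.
    apply/ZE; rewrite ez; split; first exact: hcochain_path_proj.
    by rewrite hdiff_path_proj // df path_proj0.
  exists (homotopy f); first exact: (hcochain_homotopy fi).
  by rewrite ez Kf addrC addKr.
by rewrite brE // subrr; case: (gl_submodB GLA (i + j)).
Qed.
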